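(* Let $\mathcal{H}$ and $\mathcal{K}$ be separable complex Hilbert spaces, and let $A \in L(\mathcal{H})$ and $B \in L(\mathcal{K})$ be such that: (i) there are closed $A$-invariant subspaces $\mathcal{H}_1,\mathcal{H}_2$ of $\mathcal{H}$ with $\mathcal{H}=\mathcal{H}_1\oplus\mathcal{H}_2$ such that the restriction $A_1=A|_{\mathcal{H}_1}\in L(\mathcal{H}_1)$ is bounded below and the restriction $A_2=A|_{\mathcal{H}_2}\in L(\mathcal{H}_2)$ is quasinilpotent; (ii) there are closed $B$-invariant subspaces $\mathcal{K}_1,\mathcal{K}_2$ of $\mathcal{K}$ with $\mathcal{K}=\mathcal{K}_1\oplus\mathcal{K}_2$ such that the restriction $B_1=B|_{\mathcal{K}_1}\in L(\mathcal{K}_1)$ is surjective and the restriction $B_2=B|_{\mathcal{K}_2}\in L(\mathcal{K}_2)$ is quasinilpotent; (iii) there exists a constant $\delta>0$ such that $\beta(A-\lambda)=\alpha(B-\lambda)$ for every $\lambda\in\mathbb{C}$ with $0<|\lambda|<\delta$. Then there exists an operator $C\in L(\mathcal{K},\mathcal{H})$ such that the operator matrix $M_C=\begin{pmatrix} A & C\\ 0 & B\end{pmatrix}\in L(\mathcal{H}\oplus\mathcal{K})$ is generalized Drazin invertible.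
   Context: $L(\mathcal{X},\mathcal{Y})$ is the set of bounded linear operators from $\mathcal{X}$ to $\mathcal{Y}$, and $L(\mathcal{X})=L(\mathcal{X},\mathcal{X})$. $T-\lambda$ means $T-\lambda I$. The space $\mathcal{X}\oplus\mathcal{Y}$ of pairs carries the norm $\|(x,y)\|=(\|x\|^2+\|y\|^2)^{1/2}$, and $M_C(x,y)=(Ax+Cy,By)$. The direct sums of subspaces in (i) and (ii) are algebraic (internal) direct sums of closed subspaces, not necessarily orthogonal. For $T\in L(\mathcal{X})$, $N(T)$ and $R(T)$ are the kernel and range, $\alpha(T)=\dim N(T)$, $\beta(T)=\operatorname{codim} R(T)$, with values in $\{0,1,2,\dots\}\cup\{\infty\}$. $T\in L(\mathcal{X})$ is bounded below if there is $c>0$ with $c\|x\|\le\|Tx\|$ for all $x\in\mathcal{X}$. $T$ is quasinilpotent if $T-\lambda$ is invertible for all complex $\lambda\neq0$. $T$ is generalized Drazin invertible if there exists $S\in L(\mathcal{X})$ with $TS=ST$, $STS=S$ and $TST-T$ quasinilpotent. *)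

(* Defs.v *)
(** Stdlib real numbers with Coquelicot: normed spaces over the complex field
    are [NormedModule C_AbsRing], and the elements of L(X,Y) are the maps
    [T : X -> Y] such that [is_linear T] (additive, homogeneous and bounded). *)
From Stdlib Require Import Reals ClassicalEpsilon ProofIrrelevance.
From Coquelicot Require Import Coquelicot.

Set Implicit Arguments.
Unset Strict Implicit.
Unset Printing Implicit Defensive.

Open Scope R_scope.

(** Linear in the first variable.  Positivity and definiteness follow from
    [inner_norm], since [norm] is nonnegative and vanishes only at [zero]. *)
Record is_inner_product (H : NormedModule C_AbsRing) (ip : H -> H -> C) : Prop := {
  inner_plus : forall x y z, ip (plus x y) z = Cplus (ip x z) (ip y z);
  inner_scal : forall (a : C) x y, ip (scal a x) y = Cmult a (ip x y);
  inner_conj : forall x y, ip y x = Cconj (ip x y);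
  inner_norm : forall x, ip x x = RtoC (norm x ^ 2)
}.

Record HilbertSpace := {
  hilbert_carrier :> CompleteNormedModule C_AbsRing;
  inner : hilbert_carrier -> hilbert_carrier -> C;
  inner_ax : is_inner_product inner
}.

Definition separable (X : UniformSpace) : Prop :=
  exists u : nat -> X,
    forall U : X -> Prop, open U -> (exists x, U x) -> exists n, U (u n).

Record subspace (X : NormedModule C_AbsRing) := {
  in_sub :> X -> Prop;
  sub_zero : in_sub zero;
  sub_plus : forall x y, in_sub x -> in_sub y -> in_sub (plus x y);
  sub_scal : forall (a : C) x, in_sub x -> in_sub (scal a x)
}.

Definition sub_sort (X : NormedModule C_AbsRing) (S : subspace X) : Type :=
  {x : X | S x}.

Definition sub_val (X : NormedModule C_AbsRing) (S : subspace X)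
  (x : sub_sort S) : X := proj1_sig x.

Section SubNormedModule.

Variables (X : NormedModule C_AbsRing) (S : subspace X).

Lemma sub_val_inj (x y : sub_sort S) : sub_val x = sub_val y -> x = y.
Proof.
  destruct x as [x hx], y as [y hy]; simpl; intros <-.
  f_equal; apply proof_irrelevance.
Qed.

Lemma sub_opp (x : X) : S x -> S (opp x).
Proof.
  intros hx. assert (E := scal_opp_one (K := C_Ring) x).
  exact (eq_ind _ S (sub_scal (opp (one : C_Ring)) hx) _ E).
Qed.

Definition sub_plus_op (x y : sub_sort S) : sub_sort S :=
  exist _ (plus (sub_val x) (sub_val y)) (sub_plus (proj2_sig x) (proj2_sig y)).
Definition sub_opp_op (x : sub_sort S) : sub_sort S :=
  exist _ (opp (sub_val x)) (sub_opp (proj2_sig x)).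
Definition sub_zero_op : sub_sort S := exist _ zero (sub_zero S).
Definition sub_scal_op (a : C) (x : sub_sort S) : sub_sort S :=
  exist _ (scal a (sub_val x)) (sub_scal a (proj2_sig x)).

Lemma sub_plus_comm x y : sub_plus_op x y = sub_plus_op y x.
Proof. apply sub_val_inj, plus_comm. Qed.
Lemma sub_plus_assoc x y z :
  sub_plus_op x (sub_plus_op y z) = sub_plus_op (sub_plus_op x y) z.
Proof. apply sub_val_inj, plus_assoc. Qed.
Lemma sub_plus_zero_r x : sub_plus_op x sub_zero_op = x.
Proof. apply sub_val_inj, plus_zero_r. Qed.
Lemma sub_plus_opp_r x : sub_plus_op x (sub_opp_op x) = sub_zero_op.
Proof. apply sub_val_inj. exact (plus_opp_r (sub_val x)). Qed.

Definition sub_AbelianMonoid_mixin :=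
  AbelianMonoid.Mixin (sub_sort S) sub_plus_op sub_zero_op sub_plus_comm sub_plus_assoc sub_plus_zero_r.
Canonical sub_AbelianMonoid :=
  AbelianMonoid.Pack (sub_sort S) sub_AbelianMonoid_mixin (sub_sort S).
Definition sub_AbelianGroup_mixin :=
  AbelianGroup.Mixin sub_AbelianMonoid _ sub_plus_opp_r.
Canonical sub_AbelianGroup :=
  AbelianGroup.Pack (sub_sort S) (AbelianGroup.Class _ _ sub_AbelianGroup_mixin)
    (sub_sort S).

Lemma sub_scal_assoc (a b : C) x :
  sub_scal_op a (sub_scal_op b x) = sub_scal_op (Cmult a b) x.
Proof. apply sub_val_inj. exact (scal_assoc (K := C_Ring) a b (sub_val x)). Qed.
Lemma sub_scal_one x : sub_scal_op (RtoC 1) x = x.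
Proof. apply sub_val_inj. exact (scal_one (K := C_Ring) (sub_val x)). Qed.
Lemma sub_scal_distr_l (a : C) x y :
  sub_scal_op a (sub_plus_op x y) = sub_plus_op (sub_scal_op a x) (sub_scal_op a y).
Proof. apply sub_val_inj. exact (scal_distr_l (K := C_Ring) a (sub_val x) (sub_val y)). Qed.
Lemma sub_scal_distr_r (a b : C) x :
  sub_scal_op (Cplus a b) x = sub_plus_op (sub_scal_op a x) (sub_scal_op b x).
Proof. apply sub_val_inj. exact (scal_distr_r (K := C_Ring) a b (sub_val x)). Qed.

Definition sub_ModuleSpace_mixin :=
  ModuleSpace.Mixin C_Ring sub_AbelianGroup sub_scal_op
    sub_scal_assoc sub_scal_one sub_scal_distr_l sub_scal_distr_r.
Canonical sub_ModuleSpace :=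
  ModuleSpace.Pack C_Ring (sub_sort S)
    (ModuleSpace.Class C_Ring _ _ sub_ModuleSpace_mixin) (sub_sort S).

Definition sub_ball (x : sub_sort S) (e : R) (y : sub_sort S) : Prop :=
  ball (sub_val x) e (sub_val y).

Lemma sub_ball_center x (e : posreal) : sub_ball x e x.
Proof. apply ball_center. Qed.
Lemma sub_ball_sym x y e : sub_ball x e y -> sub_ball y e x.
Proof. apply ball_sym. Qed.
Lemma sub_ball_triangle x y z e1 e2 :
  sub_ball x e1 y -> sub_ball y e2 z -> sub_ball x (e1 + e2) z.
Proof. apply ball_triangle. Qed.

Definition sub_UniformSpace_mixin :=
  UniformSpace.Mixin _ sub_zero_op sub_ball
    sub_ball_center sub_ball_sym sub_ball_triangle.
Canonical sub_UniformSpace :=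
  UniformSpace.Pack (sub_sort S) sub_UniformSpace_mixin (sub_sort S).

Canonical sub_NormedModuleAux :=
  NormedModuleAux.Pack C_AbsRing (sub_sort S)
    (NormedModuleAux.Class C_AbsRing _
      (ModuleSpace.class _ sub_ModuleSpace) sub_UniformSpace_mixin) (sub_sort S).

Definition sub_norm (x : sub_sort S) : R := norm (sub_val x).

Lemma sub_norm_triangle (x y : sub_NormedModuleAux) :
  sub_norm (plus x y) <= sub_norm x + sub_norm y.
Proof. exact (norm_triangle (sub_val x) (sub_val y)). Qed.
Lemma sub_norm_scal (a : C_AbsRing) (x : sub_NormedModuleAux) :
  sub_norm (scal a x) <= abs a * sub_norm x.
Proof. exact (norm_scal a (sub_val x)). Qed.
Lemma sub_norm_compat1 (x y : sub_NormedModuleAux) (e : R) :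
  sub_norm (minus y x) < e -> ball x e y.
Proof. exact (norm_compat1 (sub_val x) (sub_val y) e). Qed.
Lemma sub_norm_compat2 (x y : sub_NormedModuleAux) (e : posreal) :
  ball x e y -> sub_norm (minus y x) < @norm_factor _ X * e.
Proof. exact (norm_compat2 (sub_val x) (sub_val y) e). Qed.
Lemma sub_norm_eq_zero (x : sub_NormedModuleAux) : sub_norm x = 0 -> x = zero.
Proof. intros h. apply sub_val_inj. exact (norm_eq_zero _ h). Qed.

Definition sub_NormedModule_mixin :=
  NormedModule.Mixin C_AbsRing sub_NormedModuleAux sub_norm (@norm_factor _ X)
    sub_norm_triangle sub_norm_scal sub_norm_compat1 sub_norm_compat2
    sub_norm_eq_zero.
Canonical sub_NormedModule :=
  NormedModule.Pack C_AbsRing (sub_sort S)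
    (NormedModule.Class C_AbsRing _ _ sub_NormedModule_mixin) (sub_sort S).

End SubNormedModule.

Definition direct_sum (X : NormedModule C_AbsRing) (S1 S2 : subspace X) : Prop :=
  (forall x, exists x1 x2, S1 x1 /\ S2 x2 /\ x = plus x1 x2) /\
  (forall x, S1 x -> S2 x -> x = zero).

Definition invariant (X : NormedModule C_AbsRing) (T : X -> X) (S : subspace X) : Prop :=
  forall x, S x -> S (T x).

Definition restrict (X : NormedModule C_AbsRing) (T : X -> X) (S : subspace X)
  (hT : invariant T S) : sub_sort S -> sub_sort S :=
  fun x => exist _ (T (sub_val x)) (hT _ (proj2_sig x)).

Fixpoint lin_comb (X : NormedModule C_AbsRing) (n : nat) (c : nat -> C)
  (e : nat -> X) : X :=
  match n with
  | O => zero
  | S m => plus (lin_comb m c e) (scal (c m) (e m))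
  end.

(** For subspaces [W] of [V]: the classes of [e 0], ..., [e (n-1)] form a basis
    of the quotient V/W. *)
Definition is_quotient_basis (X : NormedModule C_AbsRing) (V W : X -> Prop)
  (n : nat) (e : nat -> X) : Prop :=
  (forall i, (i < n)%nat -> V (e i)) /\
  (forall x, V x -> exists c, W (minus x (lin_comb n c e))) /\
  (forall c, W (lin_comb n c e) -> forall i, (i < n)%nat -> c i = RtoC 0).

(** [Infty] stands for every infinite dimension. *)
Inductive enat := Fin (n : nat) | Infty.

(** The chosen size does not depend on the choice, as two finite bases of V/W
    have the same size. *)
Definition quotient_dim (X : NormedModule C_AbsRing) (V W : X -> Prop) : enat :=
  match excluded_middle_informative
          (exists n, exists e, is_quotient_basis V W n e) with
  | left h => Fin (proj1_sig (constructive_indefinite_description _ h))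
  | right _ => Infty
  end.

Definition dim (X : NormedModule C_AbsRing) (V : X -> Prop) : enat :=
  quotient_dim V (fun x => x = zero).

Definition codim (X : NormedModule C_AbsRing) (W : X -> Prop) : enat :=
  quotient_dim (fun _ => True) W.

Section Operators.

Variable X : NormedModule C_AbsRing.
Implicit Type T : X -> X.

Definition kernel T : X -> Prop := fun x => T x = zero.
Definition range T : X -> Prop := fun y => exists x, T x = y.

Definition alpha T : enat := dim (kernel T).
Definition beta T : enat := codim (range T).

Definition shift T (lambda : C) : X -> X := fun x => minus (T x) (scal lambda x).

Definition bounded_below T : Prop :=
  exists c, 0 < c /\ forall x, c * norm x <= norm (T x).

Definition surjective T : Prop := forall y, exists x, T x = y.

Definition invertible T : Prop :=
  exists S : X -> X, is_linear S /\
    (forall x, S (T x) = x) /\ (forall x, T (S x) = x).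

Definition quasinilpotent T : Prop :=
  forall lambda : C, lambda <> RtoC 0 -> invertible (shift T lambda).

Definition generalized_Drazin_invertible T : Prop :=
  exists S : X -> X, is_linear S /\
    (forall x, T (S x) = S (T x)) /\
    (forall x, S (T (S x)) = S x) /\
    quasinilpotent (fun x => minus (T (S (T x))) (T x)).

End Operators.

(** [prod_NormedModule] carries the norm (|x|^2 + |y|^2)^(1/2). *)
Definition upper_triangular (X Y : NormedModule C_AbsRing)
  (A : X -> X) (C : Y -> X) (B : Y -> Y) :
  prod_NormedModule C_AbsRing X Y -> prod_NormedModule C_AbsRing X Y :=
  fun p => (plus (A (fst p)) (C (snd p)), B (snd p)).

(* Main.v *)
Require Import Defs.
From Stdlib Require Import Reals.
From Coquelicot Require Import Coquelicot.
From Stdlib Require Import Wf_nat Lra Lia List ClassicalEpsilon Classical.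
From Stdlib Require Cantor.
Open Scope R_scope.

(** The theorem reduces to the case in which [A] is bounded below and [B] is onto.
    The decompositions of [H] and [K] have bounded projections, by the open
    mapping theorem ([direct_sum_decomposition]).  If an operator [U] from [K1] to
    [H1] makes the operator matrix of [A1], [U], [B1] invertible, then extending
    [U] by zero on [K2] makes [M_C] the direct sum of this matrix and of the
    quasinilpotent diagonal matrix of [A2] and [B2]; such a direct sum is
    generalized Drazin invertible, the inverse of the first summand extended by
    zero being a generalized Drazin inverse ([gDrazin_of_decomposition]).  For
    [lambda <> 0] the operators [A2 - lambda] and [B2 - lambda] are invertible, so
    the hypothesis on codimensions and dimensions passes to [A1 - lambda] and
    [B1 - lambda] ([has_basis_range_restrict], [has_basis_kernel_restrict]).

    It remains to find [U] ([invertible_completion]).  Instead of the constancy of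
    the index near zero, the argument uses a single small [lambda <> 0].  The
    operators [A' = A1 - lambda] and [B' = B1 - lambda] are still bounded below
    and onto, with constants which do not depend on [lambda].  The kernel of [B']
    and a complement of the closed range of [A'] have the same finite dimension or
    are both infinite-dimensional; by separability they have orthonormal bases
    with the same index set ([matching_orthonormal_bases]), and so there is a
    partial isometry [U] from the one onto the other ([orthonormal_transfer]).
    The matrix of [A'], [U], [B'] is bijective ([completion]), and because [U] is a
    contraction the norm of its inverse is bounded independently of [lambda].
    Hence for small [lambda] the matrix of [A1], [U], [B1], which differs from it
    by [lambda] times the identity, is invertible too: an approximate solution
    operator with error at most one half can be iterated ([approx_surj], which
    is also the last step of the proof of the open mapping theorem). *)

Set Implicit Arguments.
Unset Strict Implicit.
Unset Printing Implicit Defensive.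

(** * Linear identities in complex vector spaces *)

(** Syntax of the vector expressions that [vec] normalizes. *)
Inductive vexp :=
| VVar (n : nat) | VZero | VPlus (a b : vexp) | VMinus (a b : vexp)
| VOpp (a : vexp) | VScal (c : C) (a : vexp).

(** Variables beyond the environment denote zero. *)
Fixpoint veval (X : NormedModule C_AbsRing) (env : list X) (e : vexp) : X :=
  match e with
  | VVar n => nth n env zero
  | VZero => zero
  | VPlus a b => plus (veval env a) (veval env b)
  | VMinus a b => minus (veval env a) (veval env b)
  | VOpp a => opp (veval env a)
  | VScal c a => scal c (veval env a)
  end.

(** Coefficient of the [i]-th variable. *)
Fixpoint vcoef (e : vexp) (i : nat) : C :=
  match e with
  | VVar n => if Nat.eqb n i then RtoC 1 else RtoC 0
  | VZero => RtoC 0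
  | VPlus a b => Cplus (vcoef a i) (vcoef b i)
  | VMinus a b => Cminus (vcoef a i) (vcoef b i)
  | VOpp a => Copp (vcoef a i)
  | VScal c a => Cmult c (vcoef a i)
  end.

(** Linear combination of the vectors of [env] with coefficients [f]. *)
Fixpoint vsum (X : NormedModule C_AbsRing) (f : nat -> C) (env : list X) : X :=
  match env with
  | nil => zero
  | cons x l => plus (scal (f O) x) (vsum (fun i => f (S i)) l)
  end.

(** Equality of the first [n] values, as an explicit conjunction. *)
Fixpoint veq (n : nat) (f g : nat -> C) : Prop :=
  match n with
  | O => True
  | S m => f O = g O /\ veq m (fun i => f (S i)) (fun i => g (S i))
  end.

Lemma vsum_plus (X : NormedModule C_AbsRing) (env : list X) f g :
  vsum (fun i => Cplus (f i) (g i)) env = plus (vsum f env) (vsum g env).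
Proof.
  revert f g; induction env as [|x l IH]; intros f g; simpl.
  - now rewrite plus_zero_l.
  - rewrite (IH (fun i => f (S i)) (fun i => g (S i))).
    assert (E : scal (Cplus (f O) (g O)) x = plus (scal (f O) x) (scal (g O) x))
      by exact (scal_distr_r (K := C_Ring) (f O) (g O) x).
    rewrite E, <- !plus_assoc. f_equal. rewrite !plus_assoc. f_equal. apply plus_comm.
Qed.

Lemma vsum_scal (X : NormedModule C_AbsRing) (env : list X) c f :
  vsum (fun i => Cmult c (f i)) env = scal c (vsum f env).
Proof.
  revert f; induction env as [|x l IH]; intros f; simpl.
  - symmetry; exact (scal_zero_r (K := C_Ring) c).
  - rewrite (IH (fun i => f (S i))).
    etransitivity; [|symmetry; exact (scal_distr_l (K := C_Ring) c _ _)].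
    f_equal. symmetry; exact (scal_assoc (K := C_Ring) c (f O) x).
Qed.

Lemma vsum_ext (X : NormedModule C_AbsRing) (env : list X) f g :
  veq (length env) f g -> vsum f env = vsum g env.
Proof.
  revert f g; induction env as [|x l IH]; intros f g; simpl; auto.
  intros [E1 E2]. rewrite E1. f_equal. now apply IH.
Qed.

Lemma veq_all n f g : (forall i, f i = g i) -> veq n f g.
Proof. revert f g; induction n; simpl; auto. Qed.

Lemma scal_opp1 (X : NormedModule C_AbsRing) (x : X) : opp x = scal (Copp 1) x.
Proof. symmetry; exact (scal_opp_one (K := C_Ring) x). Qed.

Lemma scal_zero_C (X : NormedModule C_AbsRing) (x : X) : scal (RtoC 0) x = zero.
Proof. exact (scal_zero_l (K := C_Ring) x). Qed.

Lemma scal_one_C (X : NormedModule C_AbsRing) (x : X) : scal (RtoC 1) x = x.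
Proof. exact (scal_one (K := C_Ring) x). Qed.

Lemma veval_vsum (X : NormedModule C_AbsRing) (env : list X) (e : vexp) :
  veval env e = vsum (vcoef e) env.
Proof.
  assert (Z : forall l : list X, vsum (fun _ => RtoC 0) l = zero).
  { induction l as [|x l IH]; simpl; auto. now rewrite IH, plus_zero_r, scal_zero_C. }
  induction e as [n| |a IHa b IHb|a IHa b IHb|a IHa|c a IHa]; simpl.
  - revert n; induction env as [|x l IH]; intros [|n]; simpl; auto.
    + now rewrite Z, plus_zero_r, scal_one_C.
    + rewrite scal_zero_C, plus_zero_l. apply IH.
  - now rewrite Z.
  - now rewrite IHa, IHb, <- vsum_plus.
  - rewrite IHa, IHb.
    transitivity (plus (vsum (vcoef a) env) (vsum (fun i => Cmult (Copp 1) (vcoef b i)) env)).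
    + rewrite vsum_scal, <- scal_opp1. reflexivity.
    + rewrite <- vsum_plus. apply vsum_ext, veq_all; intros i; ring.
  - rewrite IHa, scal_opp1, <- vsum_scal.
    apply vsum_ext, veq_all; intros i; ring.
  - now rewrite IHa, <- vsum_scal.
Qed.

Lemma veval_eq (X : NormedModule C_AbsRing) (env : list X) (a b : vexp) :
  veq (length env) (vcoef a) (vcoef b) -> veval env a = veval env b.
Proof. intros h. rewrite !veval_vsum. now apply vsum_ext. Qed.

(** Reification: the atoms are the maximal subterms that are not built with the
    module operations, collected up to syntactic equality. *)
Ltac v_mem x l :=
  lazymatch l with
  | nil => constr:(false)
  | cons ?y ?t => match constr:(tt) with
                  | _ => let _ := match constr:(tt) with _ => constr_eq x y end in constr:(true)
                  | _ => v_mem x t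
                  end
  end.
Ltac v_atoms t l :=
  lazymatch t with
  | zero => l
  | plus ?a ?b => let l' := v_atoms a l in v_atoms b l'
  | minus ?a ?b => let l' := v_atoms a l in v_atoms b l'
  | opp ?a => v_atoms a l
  | scal _ ?a => v_atoms a l
  | _ => let m := v_mem t l in
         lazymatch m with true => l | false => constr:(cons t l) end
  end.
Ltac v_index x l :=
  match l with
  | cons ?y ?t => let _ := match constr:(tt) with _ => constr_eq x y end in constr:(O)
  | cons _ ?t => let i := v_index x t in constr:(S i)
  end.
Ltac v_reify t l :=
  lazymatch t with
  | zero => constr:(VZero)
  | plus ?a ?b => let a' := v_reify a l in let b' := v_reify b l in constr:(VPlus a' b')
  | minus ?a ?b => let a' := v_reify a l in let b' := v_reify b l in constr:(VMinus a' b')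
  | opp ?a => let a' := v_reify a l in constr:(VOpp a')
  | scal ?c ?a => let a' := v_reify a l in constr:(VScal c a')
  | _ => let i := v_index t l in constr:(VVar i)
  end.

(** Reduces an equality of linear combinations of vectors to the equalities of
    the coefficients, and tries [ring] on these. *)
Ltac vec_in X :=
  match goal with
  | |- ?a = ?b =>
    let l := v_atoms a (@nil X) in
    let l := v_atoms b l in
    let a' := v_reify a l in
    let b' := v_reify b l in
    change (@veval X l a' = @veval X l b');
    apply veval_eq; cbn [veq vcoef length Nat.eqb];
    repeat split; try ring
  end.
(** [vec_in], with the normed module found from the type of the equation. *)
Ltac vec :=
  match goal with
  | |- @eq ?T _ _ =>
    let X := open_constr:(_ : NormedModule C_AbsRing) in
    unify T (@NormedModule.sort C_AbsRing X);
    let X := eval cbv beta in X in vec_in X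
  end.

(** * Norm convergence and completeness *)

Lemma norm_scal_C (X : NormedModule C_AbsRing) (c : C) (x : X) :
  norm (scal c x) = Cmod c * norm x.
Proof.
  apply Rle_antisym; [exact (norm_scal (K := C_AbsRing) c x)|].
  destruct (Ceq_dec c 0) as [->|hc].
  - rewrite Cmod_0, Rmult_0_l. apply norm_ge_0.
  - assert (h : norm (scal (Cinv c) (scal c x)) <= Cmod (Cinv c) * norm (scal c x))
      by exact (norm_scal (K := C_AbsRing) (Cinv c) (scal c x)).
    replace (scal (Cinv c) (scal c x)) with x in h by (vec; field; auto).
    rewrite (Cmod_inv _ hc) in h.
    assert (hp := proj1 (Cmod_gt_0 c) hc).
    apply (Rmult_le_compat_l (Cmod c)) in h; [|lra].
    replace (Cmod c * (/ Cmod c * norm (scal c x))) with (norm (scal c x)) in h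
      by (field; lra). exact h.
Qed.

Lemma norm_minus_sym (X : NormedModule C_AbsRing) (x y : X) :
  norm (minus x y) = norm (minus y x).
Proof. rewrite <- norm_opp. f_equal. vec. Qed.

Lemma norm_minus_le (X : NormedModule C_AbsRing) (x y : X) :
  norm (minus x y) <= norm x + norm y.
Proof. rewrite <- (norm_opp y). apply norm_triangle. Qed.

Lemma norm_minus_zero (X : NormedModule C_AbsRing) (x y : X) :
  norm (minus x y) = 0 -> x = y.
Proof.
  intros h. apply norm_eq_zero in h.
  replace x with (plus y (minus x y)) by vec. rewrite h. vec.
Qed.

Lemma norm_minus_self (X : NormedModule C_AbsRing) (x : X) : norm (minus x x) = 0.
Proof. replace (minus x x) with (@zero X) by vec. apply norm_zero. Qed.

Lemma norm_minus_split (X : NormedModule C_AbsRing) (x y z : X) :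
  norm (minus x z) <= norm (minus x y) + norm (minus y z).
Proof.
  replace (minus x z) with (plus (minus x y) (minus y z)) by vec.
  apply norm_triangle.
Qed.

Lemma norm_le_add (X : NormedModule C_AbsRing) (x y : X) :
  norm x <= norm y + norm (minus x y).
Proof. replace x with (plus y (minus x y)) at 1 by vec. apply norm_triangle. Qed.

(** Linearity, with the operations taken in the normed modules [X] and [Y]
    themselves, the form in which later statements mention them. *)
Lemma lin_scal (X Y : NormedModule C_AbsRing) (T : X -> Y) :
  is_linear T -> forall (c : C) x, T (scal c x) = scal c (T x).
Proof. intros h c x. exact (linear_scal T h c x). Qed.

Lemma lin_plus (X Y : NormedModule C_AbsRing) (T : X -> Y) :
  is_linear T -> forall x y, T (plus x y) = plus (T x) (T y).
Proof. intros h x y. exact (linear_plus T h x y). Qed.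

Lemma lin_minus (X Y : NormedModule C_AbsRing) (T : X -> Y) :
  is_linear T -> forall x y, T (minus x y) = minus (T x) (T y).
Proof. intros h x y. exact (linear_minus T x y h). Qed.

Lemma lin_zero (X Y : NormedModule C_AbsRing) (T : X -> Y) :
  is_linear T -> T zero = zero.
Proof. intros h. exact (linear_zero T h). Qed.

(** Convergence in norm, which is equivalent to convergence for the uniform
    structure of [X]. *)
Definition cvg (X : NormedModule C_AbsRing) (u : nat -> X) (l : X) : Prop :=
  forall eps, 0 < eps -> exists N, forall n, (N <= n)%nat -> norm (minus (u n) l) < eps.

(** Completeness of a normed space, in terms of sequences. *)
Definition banach (X : NormedModule C_AbsRing) : Prop :=
  forall u : nat -> X,
    (forall eps, 0 < eps -> exists N, forall n m,
       (N <= n)%nat -> (N <= m)%nat -> norm (minus (u n) (u m)) < eps) ->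
    exists l, cvg u l.

Lemma norm_factor_pos (X : NormedModule C_AbsRing) : 0 < @norm_factor _ X.
Proof. exact (norm_factor_gt_0 (K := C_AbsRing) (V := X)). Qed.

Lemma banach_complete (X : CompleteNormedModule C_AbsRing) : banach X.
Proof.
  intros u hu.
  assert (E : exists l : CompleteNormedModule.CompleteSpace C_AbsRing X,
            filterlim u eventually (locally l)).
  { apply (filterlim_locally_cauchy (F := eventually)
      (U := CompleteNormedModule.CompleteSpace C_AbsRing X) u). intros [e he].
    destruct (hu e he) as [N hN]. exists (fun n => (N <= n)%nat). split.
    - exists N; auto.
    - intros n m hn hm. apply (norm_compat1 (V := X)). apply hN; auto. }
  destruct E as [l hl]. exists l. intros e he.
  set (e' := mkposreal _ (Rdiv_lt_0_compat _ _ he (norm_factor_pos X))).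
  destruct (proj1 (filterlim_locally u l) hl e') as [N hN].
  exists N. intros n hn. specialize (hN n hn).
  apply (norm_compat2 (V := X)) in hN. simpl in hN.
  replace e with (norm_factor (V := X) * (e / norm_factor (V := X))).
  - exact hN.
  - field. apply Rgt_not_eq, norm_factor_pos.
Qed.

Lemma closed_cvg (X : NormedModule C_AbsRing) (S : X -> Prop) (u : nat -> X) l :
  closed S -> (forall n, S (u n)) -> cvg u l -> S l.
Proof.
  intros hS hu hl. apply hS. intros [[e he] hloc].
  destruct (hl e he) as [N hN].
  apply (hloc (u N)); auto. apply (norm_compat1 (V := X)). apply hN; auto.
Qed.

Lemma cvg_unique (X : NormedModule C_AbsRing) (u : nat -> X) l l' :
  cvg u l -> cvg u l' -> l = l'.
Proof.
  intros h h'. apply norm_minus_zero.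
  apply Rle_antisym; [|apply norm_ge_0]. apply le_epsilon. intros e he.
  destruct (h (e/2)) as [N hN]; [lra|]. destruct (h' (e/2)) as [N' hN']; [lra|].
  specialize (hN (N + N')%nat ltac:(lia)). specialize (hN' (N + N')%nat ltac:(lia)).
  assert (t := norm_minus_split l (u (N + N')%nat) l').
  rewrite (norm_minus_sym l (u (N + N')%nat)) in t. lra.
Qed.

Lemma cvg_norm_le (X : NormedModule C_AbsRing) (u : nat -> X) l a M :
  cvg u l -> (exists N, forall n, (N <= n)%nat -> norm (minus (u n) a) <= M) ->
  norm (minus l a) <= M.
Proof.
  intros h [N' hM]. apply le_epsilon. intros e he.
  destruct (h e he) as [N hN].
  specialize (hN (N + N')%nat ltac:(lia)). specialize (hM (N + N')%nat ltac:(lia)).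
  assert (t := norm_minus_split l (u (N + N')%nat) a).
  rewrite (norm_minus_sym l (u (N + N')%nat)) in t. lra.
Qed.

Lemma cvg_plus (X : NormedModule C_AbsRing) (u v : nat -> X) l k :
  cvg u l -> cvg v k -> cvg (fun n => plus (u n) (v n)) (plus l k).
Proof.
  intros h h' e he.
  destruct (h (e/2)) as [N hN]; [lra|]. destruct (h' (e/2)) as [N' hN']; [lra|].
  exists (N + N')%nat. intros n hn.
  specialize (hN n ltac:(lia)). specialize (hN' n ltac:(lia)).
  replace (minus (plus (u n) (v n)) (plus l k))
    with (plus (minus (u n) l) (minus (v n) k)) by vec.
  eapply Rle_lt_trans; [apply norm_triangle|lra].
Qed.

Lemma linear_bound (X Y : NormedModule C_AbsRing) (T : X -> Y) :
  is_linear T -> exists M, 0 < M /\ forall x, norm (T x) <= M * norm x.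
Proof. intros h; exact (linear_norm T h). Qed.

Lemma cvg_linear (X Y : NormedModule C_AbsRing) (T : X -> Y) (u : nat -> X) l :
  is_linear T -> cvg u l -> cvg (fun n => T (u n)) (T l).
Proof.
  intros hT h e he. destruct (linear_bound hT) as [M [hM hb]].
  destruct (h (e / M)) as [N hN]; [now apply Rdiv_lt_0_compat|].
  exists N. intros n hn. specialize (hN n hn).
  rewrite <- (lin_minus hT). eapply Rle_lt_trans; [apply hb|].
  apply (Rmult_lt_compat_l M) in hN; auto.
  replace (M * (e / M)) with e in hN by (field; lra). exact hN.
Qed.

Lemma cvg_scal (X : NormedModule C_AbsRing) (u : nat -> X) l (c : C) :
  cvg u l -> cvg (fun n => scal c (u n)) (scal c l).
Proof.
  intros h. apply (cvg_linear (T := fun x : X => scal c x)); auto.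
  apply (is_linear_scal_r (K := C_AbsRing)). intros a b; exact (Cmult_comm a b).
Qed.

Lemma cvg_ext (X : NormedModule C_AbsRing) (u v : nat -> X) l :
  (forall n, u n = v n) -> cvg u l -> cvg v l.
Proof. intros E h e he. destruct (h e he) as [N hN]. exists N. intros n hn. rewrite <- E; auto. Qed.

Lemma pow_half_small (K eps : R) : 0 < eps -> exists N, forall n, (N <= n)%nat -> K * (/2)^n < eps.
Proof.
  intros he. destruct (pow_lt_1_zero (/2) ltac:(rewrite Rabs_pos_eq; lra) (eps / (Rabs K + 1))) as [N hN].
  { apply Rdiv_lt_0_compat; auto. assert (t := Rabs_pos K). lra. }
  exists N. intros n hn. specialize (hN n hn).
  assert (p : 0 < (/2)^n) by (apply pow_lt; lra).
  rewrite Rabs_pos_eq in hN by lra.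
  assert (t := Rabs_pos K). assert (t' := Rle_abs K).
  apply (Rmult_lt_compat_l (Rabs K + 1)) in hN; [|lra].
  replace ((Rabs K + 1) * (eps / (Rabs K + 1))) with eps in hN by (field; lra). nra.
Qed.

(** A sequence whose steps are bounded by the decrements of a geometrically
    small sequence of radii converges, and the radii bound the error. *)
Lemma telescope_cvg (X : NormedModule C_AbsRing) (u : nat -> X) (r : nat -> R) K :
  banach X -> (forall n, norm (minus (u (S n)) (u n)) <= r n - r (S n)) ->
  (forall n, 0 <= r n <= K * (/2)^n) ->
  exists l, cvg u l /\ forall n, norm (minus l (u n)) <= r n.
Proof.
  intros hX hs hr.
  assert (T : forall n k, norm (minus (u (k + n)%nat) (u n)) <= r n - r (k + n)%nat).
  { intros n k. induction k as [|k IH]; simpl.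
    - rewrite norm_minus_self. lra.
    - assert (t := norm_minus_split (u (S (k + n))) (u (k + n)%nat) (u n)).
      specialize (hs (k + n)%nat). lra. }
  assert (T' : forall n m, (n <= m)%nat -> norm (minus (u m) (u n)) <= r n).
  { intros n m h. specialize (T n (m - n)%nat).
    replace (m - n + n)%nat with m in T by lia. specialize (hr m). lra. }
  destruct (hX u) as [l hl].
  { intros e he. destruct (pow_half_small K he) as [N hN]. exists N.
    intros n m hn hm.
    assert (forall i j, (N <= i)%nat -> (i <= j)%nat -> norm (minus (u j) (u i)) < e).
    { intros i j hi hj. specialize (T' i j hj). specialize (hr i). specialize (hN i hi). lra. }
    destruct (Nat.le_ge_cases n m); auto. rewrite norm_minus_sym; auto. }
  exists l. split; auto. intros n. apply (cvg_norm_le hl). exists n. intros m hm. auto.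
Qed.

Lemma is_linear_sub_val (X : NormedModule C_AbsRing) (S : subspace X) :
  @is_linear C_AbsRing (sub_NormedModule S) X (@sub_val X S).
Proof.
  split; try reflexivity. exists 1. split; [lra|]. intros x. rewrite Rmult_1_l.
  apply Rle_refl.
Qed.

Lemma banach_sub (X : NormedModule C_AbsRing) (S : subspace X) :
  banach X -> closed S -> banach (sub_NormedModule S).
Proof.
  intros hX hS u hu. destruct (hX (fun n => sub_val (u n))) as [l hl]; [exact hu|].
  assert (h : S l) by (apply (closed_cvg (u := fun n => sub_val (u n)) hS); auto; intros n; exact (proj2_sig (u n))).
  exists (exist _ l h). exact hl.
Qed.

Lemma norm_prod (X Y : NormedModule C_AbsRing) (p : prod_NormedModule C_AbsRing X Y) :
  norm p = sqrt (norm (fst p) ^ 2 + norm (snd p) ^ 2).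
Proof. reflexivity. Qed.

Lemma norm_fst_le (X Y : NormedModule C_AbsRing) (p : prod_NormedModule C_AbsRing X Y) :
  norm (fst p) <= norm p.
Proof.
  rewrite norm_prod. rewrite <- (sqrt_pow2 (norm (fst p))) at 1 by apply norm_ge_0.
  apply sqrt_le_1_alt. assert (t := pow2_ge_0 (norm (snd p))). lra.
Qed.

Lemma norm_snd_le (X Y : NormedModule C_AbsRing) (p : prod_NormedModule C_AbsRing X Y) :
  norm (snd p) <= norm p.
Proof.
  rewrite norm_prod. rewrite <- (sqrt_pow2 (norm (snd p))) at 1 by apply norm_ge_0.
  apply sqrt_le_1_alt. assert (t := pow2_ge_0 (norm (fst p))). lra.
Qed.

Lemma norm_prod_le (X Y : NormedModule C_AbsRing) (p : prod_NormedModule C_AbsRing X Y) :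
  norm p <= norm (fst p) + norm (snd p).
Proof.
  rewrite norm_prod. assert (a := norm_ge_0 (fst p)). assert (b := norm_ge_0 (snd p)).
  rewrite <- (sqrt_pow2 (norm (fst p) + norm (snd p))) by lra.
  apply sqrt_le_1_alt. nra.
Qed.

Lemma banach_prod (X Y : NormedModule C_AbsRing) :
  banach X -> banach Y -> banach (prod_NormedModule C_AbsRing X Y).
Proof.
  intros hX hY u hu.
  destruct (hX (fun n => fst (u n))) as [l hl].
  { intros e he. destruct (hu e he) as [N hN]. exists N. intros n m hn hm.
    eapply Rle_lt_trans; [apply (norm_fst_le (minus (u n) (u m)))|auto]. }
  destruct (hY (fun n => snd (u n))) as [k hk].
  { intros e he. destruct (hu e he) as [N hN]. exists N. intros n m hn hm.
    eapply Rle_lt_trans; [apply (norm_snd_le (minus (u n) (u m)))|auto]. }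
  exists (l, k). intros e he.
  destruct (hl (e/2)) as [N hN]; [lra|]. destruct (hk (e/2)) as [N' hN']; [lra|].
  exists (N + N')%nat. intros n hn.
  specialize (hN n ltac:(lia)). specialize (hN' n ltac:(lia)).
  assert (t := norm_prod_le (minus (u n) ((l, k) : prod_NormedModule C_AbsRing X Y))).
  change (norm (minus (fst (u n)) l) < e / 2) in hN.
  change (norm (minus (snd (u n)) k) < e / 2) in hN'.
  change (fst (minus (u n) ((l, k) : prod_NormedModule C_AbsRing X Y))) with (minus (fst (u n)) l) in t.
  change (snd (minus (u n) ((l, k) : prod_NormedModule C_AbsRing X Y))) with (minus (snd (u n)) k) in t.
  lra.
Qed.

(** * Surjective operators on Banach spaces *)

(** Approximate solvability with geometric gain implies exact solvability. *)
Lemma approx_surj (X Y : NormedModule C_AbsRing) (T : X -> Y) M :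
  banach X -> is_linear T ->
  (forall y, exists x, norm x <= M * norm y /\ norm (minus y (T x)) <= norm y / 2) ->
  forall y, exists x, T x = y /\ norm x <= 2 * M * norm y.
Proof.
  intros hX hT h y.
  (* [g z] solves [T x = z] up to half of [z]; [res n] is what remains of [y]
     after [n] corrections, and [u n] is the sum of these corrections *)
  set (g := fun z => proj1_sig (constructive_indefinite_description _ (h z))).
  assert (hg : forall z, norm (g z) <= M * norm z /\ norm (minus z (T (g z))) <= norm z / 2).
  { intros z. exact (proj2_sig (constructive_indefinite_description _ (h z))). }
  clearbody g.
  set (res := fix res n := match n with O => y | S m => minus (res m) (T (g (res m))) end).
  set (u := fix u n := match n with O => zero | S m => plus (u m) (g (res m)) end).
  assert (hres : forall n, norm (res n) <= norm y * (/2)^n).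
  { induction n; simpl; [lra|]. destruct (hg (res n)) as [_ t]. lra. }
  assert (hu : forall n, T (u n) = minus y (res n)).
  { induction n; simpl.
    - rewrite (lin_zero hT). vec.
    - rewrite (lin_plus hT), IHn. vec. }
  destruct (Rle_lt_dec 0 M) as [hM|hM].
  2: { assert (y0 : norm y = 0).
       { destruct (hg y) as [t _]. assert (a := norm_ge_0 y). assert (b := norm_ge_0 (g y)).
         clear - t a b hM. assert (norm y <= 0) by nra. lra. }
       exists zero. rewrite (lin_zero hT), norm_zero, y0. split; [|lra].
       symmetry; now apply norm_eq_zero. }
  destruct (telescope_cvg (u := u) (r := fun n => 2 * M * norm y * (/2)^n) (K := 2 * M * norm y) hX) as [l [hl hb]].
  { intros n. simpl. replace (minus (plus (u n) (g (res n))) (u n)) with (g (res n)) by vec.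
    destruct (hg (res n)) as [t _]. specialize (hres n).
    apply (Rmult_le_compat_l M) in hres; auto. lra. }
  { intros n. assert (p : 0 < (/2)^n) by (apply pow_lt; lra).
    assert (a := norm_ge_0 y). split; [|lra].
    repeat apply Rmult_le_pos; lra. }
  exists l. split.
  - apply (cvg_unique (u := fun n => T (u n))); [now apply cvg_linear|].
    intros e he. destruct (pow_half_small (norm y) he) as [N hN]. exists N. intros n hn.
    rewrite hu. replace (minus (minus y (res n)) y) with (opp (res n)) by vec.
    rewrite norm_opp. exact (Rle_lt_trans _ _ _ (hres n) (hN n hn)).
  - assert (E : minus l (u O) = l) by exact (minus_zero_r l).
    specialize (hb O). rewrite E in hb. simpl in hb. rewrite Rmult_1_r in hb. exact hb.
Qed.

(** Baire's argument: if [T] is onto a complete space, the closure of the image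
    of some ball of [X] contains a ball of [Y]. *)
Lemma baire_image (X Y : NormedModule C_AbsRing) (T : X -> Y) :
  banach Y -> (forall y, exists x, T x = y) ->
  exists k y0 r, 0 < r /\ forall y, norm (minus y y0) < r ->
    forall eps, 0 < eps -> exists x, norm x <= k /\ norm (minus (T x) y) < eps.
Proof.
  intros hY hT. apply NNPP. intros hn.
  (* every ball contains a smaller one, of at most half the radius, missing the
     image of the ball of radius [n] of [X]; the limit of the centers of such
     nested balls is not in the range of [T] *)
  assert (H : forall n (p : Y * R), exists q : Y * R, 0 < snd p ->
    norm (minus (fst q) (fst p)) <= snd p / 2 /\ 0 < snd q <= snd p / 2 /\
    forall x, norm x <= INR n -> snd q < norm (minus (T x) (fst q))).
  { intros n [y0 r]. simpl. destruct (Rlt_le_dec 0 r) as [hr|hr].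
    2: { exists (y0, r). intros; lra. }
    apply NNPP. intros hq. apply hn. exists (INR n), y0, (r/2). split; [lra|].
    intros y hy e he. apply NNPP. intros hx. apply hq.
    exists (y, Rmin (e/2) (r/2)). intros _. simpl.
    assert (m1 := Rmin_l (e/2) (r/2)). assert (m2 := Rmin_r (e/2) (r/2)).
    assert (m3 : 0 < Rmin (e/2) (r/2)) by (apply Rmin_glb_lt; lra).
    split; [|split]; [lra|lra|].
    intros x hxn. apply Rnot_le_lt. intros hle. apply hx. exists x. split; auto. lra. }
  set (step := fun n p => proj1_sig (constructive_indefinite_description _ (H n p))).
  assert (hs : forall n p, 0 < snd p ->
    norm (minus (fst (step n p)) (fst p)) <= snd p / 2 /\ 0 < snd (step n p) <= snd p / 2 /\
    forall x, norm x <= INR n -> snd (step n p) < norm (minus (T x) (fst (step n p)))).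
  { intros n p. exact (proj2_sig (constructive_indefinite_description _ (H n p))). }
  clearbody step.
  set (s := fix s (n : nat) : Y * R := match n with O => (@zero Y, 1) | S m => step m (s m) end).
  assert (hr : forall n, 0 < snd (s n) <= 1 * (/2)^n).
  { induction n as [|n IH]; [simpl; lra|].
    destruct (hs n (s n)) as [_ [a _]]; [apply IH|].
    change (s (S n)) with (step n (s n)). change ((/2)^(S n)) with (/2 * (/2)^n). lra. }
  destruct (telescope_cvg (u := fun n => fst (s n)) (r := fun n => snd (s n)) (K := 1) hY)
    as [l [_ hl]].
  { intros n. destruct (hs n (s n)) as [a [b _]]; [apply hr|].
    change (s (S n)) with (step n (s n)). lra. }
  { intros n. specialize (hr n). lra. }
  destruct (hT l) as [x hx].
  destruct (INR_unbounded (norm x)) as [n hxn].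
  destruct (hs n (s n)) as [_ [_ c]]; [apply hr|].
  specialize (c x ltac:(lra)). rewrite hx in c. specialize (hl (S n)).
  change (s (S n)) with (step n (s n)) in hl. lra.
Qed.

(** The open mapping theorem. *)
Lemma open_mapping (X Y : NormedModule C_AbsRing) (T : X -> Y) :
  banach X -> banach Y -> is_linear T -> (forall y, exists x, T x = y) ->
  exists M, 0 < M /\ forall y, exists x, T x = y /\ norm x <= M * norm y.
Proof.
  intros hX hY lT hT. destruct (baire_image hY hT) as [k [y0 [r [hr hb]]]].
  assert (hk : 0 <= k).
  { destruct (hb y0) with (eps := 1) as [x [hx _]]; [|lra|].
    - rewrite norm_minus_self; auto.
    - assert (t := norm_ge_0 x). lra. }
  (* differences of two images approximate the ball of radius [r]
     about zero by images of vectors of norm at most [2 k]; this is used on the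
     sphere of radius [r/2], and adding 1 makes the bound positive *)
  set (M := 4 * k / r + 1).
  assert (hM : 0 < M).
  { assert (0 <= 4 * k / r) by (apply Rdiv_le_0_compat; lra). unfold M; lra. }
  exists (2 * M). split; [lra|].
  apply approx_surj; auto. intros y.
  destruct (Req_dec (norm y) 0) as [hy|hy].
  { exists zero. replace (minus y (T zero)) with y by (rewrite (lin_zero lT); vec).
    rewrite norm_zero, hy. lra. }
  assert (py : 0 < norm y) by (assert (t := norm_ge_0 y); lra).
  (* rescale [y] to have norm r/2 *)
  set (c := r / (2 * norm y)).
  assert (hc : 0 < c) by (apply Rdiv_lt_0_compat; lra).
  assert (hcC : RtoC c <> 0) by (intros E; apply RtoC_inj in E; lra).
  assert (nC : Cmod (Cinv c) = / c).
  { rewrite Cmod_inv by auto. rewrite Cmod_R, Rabs_pos_eq by lra. auto. }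
  set (e := r / 8).
  assert (he : 0 < e) by (unfold e; lra).
  destruct (hb (plus y0 (scal (RtoC c) y))) with (eps := e) as [x1 [n1 e1]]; auto.
  { replace (minus (plus y0 (scal (RtoC c) y)) y0) with (scal (RtoC c) y) by vec.
    rewrite norm_scal_C, Cmod_R, Rabs_pos_eq by lra.
    replace (c * norm y) with (r / 2) by (unfold c; field; lra). lra. }
  destruct (hb y0) with (eps := e) as [x2 [n2 e2]]; auto.
  { rewrite norm_minus_self; auto. }
  exists (scal (Cinv c) (minus x1 x2)). split.
  - rewrite norm_scal_C, nC.
    assert (t := norm_minus_le x1 x2).
    apply Rle_trans with (/ c * (2 * k)).
    + apply Rmult_le_compat_l; [left; now apply Rinv_0_lt_compat|lra].
    + replace (/ c * (2 * k)) with (4 * k / r * norm y) by (unfold c; field; lra).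
      unfold M. nra.
  - rewrite (lin_scal lT), (lin_minus lT).
    replace (minus y (scal (Cinv c) (minus (T x1) (T x2)))) with
      (scal (Cinv c) (minus (minus (T x2) y0) (minus (T x1) (plus y0 (scal (RtoC c) y)))))
      by (vec; field; auto).
    rewrite norm_scal_C, nC.
    assert (t := norm_minus_le (minus (T x2) y0) (minus (T x1) (plus y0 (scal (RtoC c) y)))).
    apply Rle_trans with (/ c * (2 * e)).
    + apply Rmult_le_compat_l; [left; now apply Rinv_0_lt_compat|lra].
    + unfold c, e. right. field. lra.
Qed.

(** A bijection with a bounded inverse is invertible. *)
Lemma invertible_of_bijective (X : NormedModule C_AbsRing) (T : X -> X) M :
  is_linear T -> (forall x, T x = zero -> x = zero) ->
  (forall y, exists x, T x = y /\ norm x <= M * norm y) -> invertible T.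
Proof.
  intros lT inj sur.
  set (S := fun z => proj1_sig (constructive_indefinite_description _ (sur z))).
  assert (hS : forall z, T (S z) = z /\ norm (S z) <= M * norm z).
  { intros z. exact (proj2_sig (constructive_indefinite_description _ (sur z))). }
  clearbody S.
  assert (inj' : forall x y, T x = T y -> x = y).
  { intros x y E. replace x with (plus y (minus x y)) by vec.
    rewrite (inj (minus x y)); [vec|]. rewrite (lin_minus lT), E. vec. }
  exists S. repeat split.
  - intros x y. apply inj'. rewrite (lin_plus lT), !(proj1 (hS _)). reflexivity.
  - intros k x. apply inj'. rewrite (lin_scal lT), !(proj1 (hS _)). reflexivity.
  - exists (Rabs M + 1). split; [assert (t := Rabs_pos M); lra|].
    intros x. destruct (hS x) as [_ t]. eapply Rle_trans; [exact t|].
    apply Rmult_le_compat_r; [apply norm_ge_0|]. assert (t' := Rle_abs M). lra.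
  - intros x. apply inj'. apply hS.
  - intros x. apply hS.
Qed.

(** A Banach space that is the algebraic direct sum of two closed subspaces
    has bounded projections on these. *)
Lemma direct_sum_proj (X : NormedModule C_AbsRing) (S1 S2 : subspace X) :
  banach X -> closed S1 -> closed S2 -> direct_sum S1 S2 ->
  exists (p1 : X -> sub_sort S1) (p2 : X -> sub_sort S2),
    @is_linear C_AbsRing X (sub_NormedModule S1) p1 /\
    @is_linear C_AbsRing X (sub_NormedModule S2) p2 /\
    (forall x, plus (sub_val (p1 x)) (sub_val (p2 x)) = x) /\
    (forall x1 x2, p1 (plus (sub_val x1) (sub_val x2)) = x1 /\
                   p2 (plus (sub_val x1) (sub_val x2)) = x2).
Proof.
  intros hX c1 c2 [hs hd].
  (* the sum map from the product of the two subspaces is a bijection of Banach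
     spaces; the projections are the components of its inverse *)
  set (Z := prod_NormedModule C_AbsRing (sub_NormedModule S1) (sub_NormedModule S2)).
  set (T := fun z : Z => plus (sub_val (fst z)) (sub_val (snd z)) : X).
  assert (lT : is_linear T).
  { split.
    - intros [a b] [a' b']. unfold T; simpl.
      change (plus (plus (sub_val a) (sub_val a')) (plus (sub_val b) (sub_val b')) =
       plus (plus (sub_val a) (sub_val b)) (plus (sub_val a') (sub_val b')) :> X). vec.
    - intros k [a b]. unfold T; simpl.
      change (plus (scal (k : C) (sub_val a)) (scal (k : C) (sub_val b)) =
       scal (k : C) (plus (sub_val a) (sub_val b)) :> X). vec.
    - exists 2. split; [lra|]. intros z. unfold T.
      eapply Rle_trans; [apply norm_triangle|].
      assert (a : norm (sub_val (fst z)) <= norm z) by exact (norm_fst_le z).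
      assert (b : norm (sub_val (snd z)) <= norm z) by exact (norm_snd_le z). lra. }
  assert (sT : (forall y, exists x, T x = y)).
  { intros x. destruct (hs x) as [x1 [x2 [h1 [h2 E]]]].
    exists (exist _ x1 h1, exist _ x2 h2). symmetry; exact E. }
  assert (U : forall a a' b b', T (a, b) = T (a', b') -> a = a' /\ b = b').
  { intros a a' b b' E. unfold T in E; simpl in E.
    assert (E' : minus (sub_val a) (sub_val a') = minus (sub_val b') (sub_val b)).
    { replace (minus (sub_val a) (sub_val a')) with
        (minus (minus (plus (sub_val a) (sub_val b)) (sub_val b)) (sub_val a')) by vec.
      rewrite E. vec. }
    assert (Z1 : minus (sub_val a) (sub_val a') = zero).
    { apply hd.
      - exact (proj2_sig (minus (a : sub_NormedModule S1) a')).
      - rewrite E'. exact (proj2_sig (minus (b' : sub_NormedModule S2) b)). }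
    split; apply sub_val_inj.
    - replace (sub_val a) with (plus (sub_val a') (minus (sub_val a) (sub_val a'))) by vec.
      rewrite Z1. vec.
    - replace (sub_val b) with (minus (sub_val b') (minus (sub_val b') (sub_val b))) by vec.
      rewrite <- E', Z1. vec. }
  destruct (open_mapping (T := T)) as [M [hM hsur]]; auto.
  { apply banach_prod; now apply banach_sub. }
  set (g := fun x => proj1_sig (constructive_indefinite_description _ (hsur x))).
  assert (hg : forall x, T (g x) = x /\ norm (g x) <= M * norm x).
  { intros x. exact (proj2_sig (constructive_indefinite_description _ (hsur x))). }
  clearbody g.
  assert (U' : forall z w, T z = T w -> z = w).
  { intros [a b] [a' b'] E. destruct (U _ _ _ _ E). congruence. }
  assert (lg : is_linear g).
  { split.
    - intros x y. apply U'. rewrite (lin_plus lT), !(proj1 (hg _)). reflexivity.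
    - intros k x. apply U'. rewrite (lin_scal lT), !(proj1 (hg _)). reflexivity.
    - exists M. split; auto. intros x. apply hg. }
  exists (fun x => fst (g x)), (fun x => snd (g x)).
  split; [|split; [|split]].
  - apply (is_linear_comp g (fun z : Z => fst z) lg). apply is_linear_fst.
  - apply (is_linear_comp g (fun z : Z => snd z) lg). apply is_linear_snd.
  - intros x. apply (hg x).
  - intros x1 x2. assert (E : T (g (plus (sub_val x1) (sub_val x2))) = T (x1, x2)) by apply hg.
    apply U' in E. rewrite E. auto.
Qed.

(** * Finite linear combinations *)

Lemma lin_comb_ext (X : NormedModule C_AbsRing) n c c' (e e' : nat -> X) :
  (forall i, (i < n)%nat -> c i = c' i) -> (forall i, (i < n)%nat -> e i = e' i) ->
  lin_comb n c e = lin_comb n c' e'.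
Proof.
  induction n as [|n IH]; intros hc he; simpl; auto.
  rewrite IH by auto. rewrite hc, he by auto. reflexivity.
Qed.

Lemma lin_comb_plus (X : NormedModule C_AbsRing) n c d (e : nat -> X) :
  lin_comb n (fun i => Cplus (c i) (d i)) e = plus (lin_comb n c e) (lin_comb n d e).
Proof. induction n as [|n IH]; simpl; [vec|]. rewrite IH. vec. Qed.

Lemma lin_comb_scal (X : NormedModule C_AbsRing) n a c (e : nat -> X) :
  lin_comb n (fun i => Cmult a (c i)) e = scal a (lin_comb n c e).
Proof. induction n as [|n IH]; simpl; [vec|]. rewrite IH. vec. Qed.

Lemma lin_comb_in (X : NormedModule C_AbsRing) (S : subspace X) n c (e : nat -> X) :
  (forall i, (i < n)%nat -> S (e i)) -> S (lin_comb n c e).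
Proof.
  induction n as [|n IH]; intros h; simpl; [apply sub_zero|].
  apply sub_plus; [|apply sub_scal]; auto.
Qed.

Lemma lin_comb_linear (X Y : NormedModule C_AbsRing) (T : X -> Y) n c (e : nat -> X) :
  is_linear T -> T (lin_comb n c e) = lin_comb n c (fun i => T (e i)).
Proof.
  intros lT. induction n as [|n IH]; simpl; [now apply lin_zero|].
  rewrite (lin_plus lT), (lin_scal lT), IH. reflexivity.
Qed.

(** Sum of [f 0], ..., [f (n-1)]. *)
Fixpoint csum (n : nat) (f : nat -> C) : C :=
  match n with O => RtoC 0 | S m => Cplus (csum m f) (f m) end.

Lemma csum_ext n f g : (forall i, (i < n)%nat -> f i = g i) -> csum n f = csum n g.
Proof. induction n; intros h; simpl; auto. rewrite IHn, h by auto. reflexivity. Qed.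

Lemma csum_plus n f g : csum n (fun i => Cplus (f i) (g i)) = Cplus (csum n f) (csum n g).
Proof. induction n; simpl; [ring|]. rewrite IHn. ring. Qed.

Lemma csum_swap m n (f : nat -> nat -> C) :
  csum m (fun i => csum n (f i)) = csum n (fun j => csum m (fun i => f i j)).
Proof.
  induction m; simpl.
  - induction n; simpl; [reflexivity|]. rewrite <- IHn. ring.
  - rewrite IHm, csum_plus. reflexivity.
Qed.

Lemma csum_one n : csum n (fun _ => RtoC 1) = RtoC (INR n).
Proof. induction n; [reflexivity|]. rewrite S_INR, RtoC_plus, <- IHn. reflexivity. Qed.

Lemma lin_comb_lin_comb (X : NormedModule C_AbsRing) m n a (b : nat -> nat -> C) (f : nat -> X) :
  lin_comb m a (fun i => lin_comb n (b i) f)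
  = lin_comb n (fun k => csum m (fun i => Cmult (a i) (b i k))) f.
Proof.
  induction m as [|m IH]; simpl.
  - induction n as [|n IH]; simpl; [reflexivity|]. rewrite <- IH. vec.
  - rewrite IH, <- lin_comb_scal, <- lin_comb_plus. reflexivity.
Qed.

Lemma lin_comb_delta (X : NormedModule C_AbsRing) n j (f : nat -> X) :
  (j < n)%nat -> lin_comb n (fun k => if Nat.eqb j k then RtoC 1 else RtoC 0) f = f j.
Proof.
  assert (Z : forall m, (m <= j)%nat ->
    lin_comb m (fun k => if Nat.eqb j k then RtoC 1 else RtoC 0) f = zero).
  { induction m as [|m IH]; intros h; simpl; auto. rewrite IH by lia.
    destruct (Nat.eqb_spec j m); [lia|]. vec. }
  induction n as [|n IH]; intros h; [lia|]; simpl.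
  destruct (Nat.eqb_spec j n) as [->|h'].
  - rewrite Z by lia. vec.
  - rewrite IH by lia. vec.
Qed.

(** * Bases of quotients *)

(** The quotient of [V] by [W] has dimension [n]. *)
Definition has_basis (X : NormedModule C_AbsRing) (V W : X -> Prop) (n : nat) : Prop :=
  exists e, is_quotient_basis V W n e.

(** Coordinates in a basis of [V] modulo zero are unique, so the change of basis
    matrices are inverse to each other on one side for each basis. *)
Lemma basis_change (X : NormedModule C_AbsRing) (V : X -> Prop) m n (e f : nat -> X) a b :
  is_quotient_basis V (fun x => x = zero) n f ->
  (forall i, (i < m)%nat -> e i = lin_comb n (b i) f) ->
  (forall j, (j < n)%nat -> f j = lin_comb m (a j) e) ->
  forall j, (j < n)%nat -> csum m (fun i => Cmult (a j i) (b i j)) = RtoC 1.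
Proof.
  intros [_ [_ hf]] he hfe j hj.
  assert (E := hfe j hj).
  rewrite (lin_comb_ext (c' := a j) (e' := fun i => lin_comb n (b i) f)) in E by auto.
  rewrite lin_comb_lin_comb in E. rewrite <- (lin_comb_delta f hj) in E at 1.
  specialize (hf (fun k => Cplus (csum m (fun i => Cmult (a j i) (b i k)))
     (Cmult (RtoC (-1)) (if Nat.eqb j k then RtoC 1 else RtoC 0)))).
  cbv beta in hf. rewrite lin_comb_plus, lin_comb_scal, E in hf.
  assert (hz := hf ltac:(vec) j hj). cbv beta in hz. rewrite Nat.eqb_refl in hz.
  replace (csum m (fun i => Cmult (a j i) (b i j))) with
    (Cplus (Cplus (csum m (fun i => Cmult (a j i) (b i j))) (Cmult (RtoC (-1)) 1)) 1) by ring.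
  rewrite hz. ring.
Qed.

(** Two bases have the same size: count both by the trace of the product of the
    change of basis matrices. *)
Lemma basis_size (X : NormedModule C_AbsRing) (V : X -> Prop) m n (e f : nat -> X) :
  is_quotient_basis V (fun x => x = zero) m e ->
  is_quotient_basis V (fun x => x = zero) n f -> m = n.
Proof.
  intros he hf.
  assert (coord : forall k (g : nat -> X), is_quotient_basis V (fun x => x = zero) k g ->
    forall x, exists c, V x -> x = lin_comb k c g).
  { intros k g [_ [hg _]] x. destruct (classic (V x)) as [hx|hx].
    - destruct (hg x hx) as [c hc]. exists c. intros _.
      replace x with (plus (lin_comb k c g) (minus x (lin_comb k c g))) by vec.
      rewrite hc. vec.
    - exists (fun _ => RtoC 0). intros; contradiction. }
  destruct (choice (fun i c => V (e i) -> e i = lin_comb n c f)) as [b hb].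
  { intros i. apply (coord n f hf). }
  destruct (choice (fun j c => V (f j) -> f j = lin_comb m c e)) as [a ha].
  { intros j. apply (coord m e he). }
  assert (hb' : forall i, (i < m)%nat -> e i = lin_comb n (b i) f).
  { intros i hi. apply hb. now apply he. }
  assert (ha' : forall j, (j < n)%nat -> f j = lin_comb m (a j) e).
  { intros j hj. apply ha. now apply hf. }
  assert (E1 := basis_change hf hb' ha'). assert (E2 := basis_change he ha' hb').
  apply INR_eq, RtoC_inj. rewrite <- !csum_one.
  rewrite <- (csum_ext E1), <- (csum_ext E2), csum_swap.
  apply csum_ext; intros i _. apply csum_ext; intros j _. ring.
Qed.

(** The whole space, zero, kernels and ranges, bundled as subspaces whose
    underlying predicates are those of [codim], [dim], [alpha] and [beta]. *)
Definition full_sub (X : NormedModule C_AbsRing) : subspace X.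
Proof. exists (fun _ => True); auto. Defined.

Definition zero_sub (X : NormedModule C_AbsRing) : subspace X.
Proof.
  exists (fun x => x = zero); auto.
  - intros x y -> ->. vec.
  - intros a x ->. vec.
Defined.

Definition kernel_sub (X : NormedModule C_AbsRing) (T : X -> X) (lT : is_linear T) : subspace X.
Proof.
  exists (kernel T); unfold kernel.
  - now apply lin_zero.
  - intros x y hx hy. rewrite (lin_plus lT), hx, hy. vec.
  - intros a x hx. rewrite (lin_scal lT), hx. vec.
Defined.

Definition range_sub (X : NormedModule C_AbsRing) (T : X -> X) (lT : is_linear T) : subspace X.
Proof.
  exists (range T); unfold range.
  - exists zero. now apply lin_zero.
  - intros x y [a <-] [b <-]. exists (plus a b). now apply lin_plus.
  - intros c x [a <-]. exists (scal c a). now apply lin_scal.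
Defined.

(** Linear maps inducing mutually inverse maps between two quotients transport
    the bases; the last two conditions say that [psi] and [phi] are inverse to
    each other modulo [W] and [W']. *)
Lemma has_basis_map (X Y : NormedModule C_AbsRing) (phi : X -> Y) (psi : Y -> X)
  (V W : subspace X) (V' W' : subspace Y) n :
  is_linear phi -> is_linear psi ->
  (forall x, V x -> V' (phi x)) -> (forall y, V' y -> V (psi y)) ->
  (forall x, W x -> W' (phi x)) -> (forall y, W' y -> W (psi y)) ->
  (forall x, V x -> W (minus x (psi (phi x)))) ->
  (forall y, V' y -> W' (minus y (phi (psi y)))) ->
  has_basis V W n -> has_basis V' W' n.
Proof.
  intros lphi lpsi hV hV' hW hW' h1 h2 [e [he [hs hi]]].
  exists (fun i => phi (e i)). split; [auto|split].
  - intros y hy. destruct (hs (psi y) (hV' y hy)) as [c hc]. exists c.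
    rewrite <- (lin_comb_linear n c e lphi).
    replace (minus y (phi (lin_comb n c e))) with
      (plus (minus y (phi (psi y))) (phi (minus (psi y) (lin_comb n c e))))
      by (rewrite (lin_minus lphi); vec).
    apply sub_plus; auto.
  - intros c hc. apply hi. rewrite <- (lin_comb_linear n c e lphi) in hc.
    replace (lin_comb n c e) with
      (plus (minus (lin_comb n c e) (psi (phi (lin_comb n c e)))) (psi (phi (lin_comb n c e)))) by vec.
    apply sub_plus; auto. apply h1. now apply lin_comb_in.
Qed.

(** The quotients of [V] by [W] and of [V'] by [W'] have the same finite
    dimension, or both have no finite basis. *)
Definition equidim (X Y : NormedModule C_AbsRing) (V W : X -> Prop) (V' W' : Y -> Prop) : Prop :=
  (exists n, has_basis V W n /\ has_basis V' W' n) \/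
  ((forall n, ~ has_basis V W n) /\ (forall n, ~ has_basis V' W' n)).

Lemma equidim_of_quotient_dim (X Y : NormedModule C_AbsRing)
  (V W : X -> Prop) (V' W' : Y -> Prop) :
  quotient_dim V W = quotient_dim V' W' -> equidim V W V' W'.
Proof.
  unfold quotient_dim.
  destruct excluded_middle_informative as [h|h];
  destruct excluded_middle_informative as [h'|h']; intros E; try discriminate.
  - left. injection E as E.
    exists (proj1_sig (constructive_indefinite_description _ h)). split.
    + exact (proj2_sig (constructive_indefinite_description _ h)).
    + rewrite E. exact (proj2_sig (constructive_indefinite_description _ h')).
  - right. split; intros n hn; [apply h|apply h']; exists n; exact hn.
Qed.

Lemma equidim_map (X Y X' Y' : NormedModule C_AbsRing)
  (V W : X -> Prop) (V' W' : Y -> Prop) (V1 W1 : X' -> Prop) (V1' W1' : Y' -> Prop) :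
  (forall n, has_basis V W n <-> has_basis V1 W1 n) ->
  (forall n, has_basis V' W' n <-> has_basis V1' W1' n) ->
  equidim V W V' W' -> equidim V1 W1 V1' W1'.
Proof.
  intros h h' [[n [a b]]|[a b]].
  - left. exists n. split; [now apply h|now apply h'].
  - right. split; intros n hn; [apply (a n), h|apply (b n), h']; auto.
Qed.

(** * Inner products and orthonormal families *)

Lemma ip_plus_l (X : NormedModule C_AbsRing) (ip : X -> X -> C) (hip : is_inner_product ip) x y z :
  ip (plus x y) z = Cplus (ip x z) (ip y z).
Proof. exact (inner_plus hip x y z). Qed.

Lemma ip_scal_l (X : NormedModule C_AbsRing) (ip : X -> X -> C) (hip : is_inner_product ip) (a : C) x z :
  ip (scal a x) z = Cmult a (ip x z).
Proof. exact (inner_scal hip a x z). Qed.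

Lemma ip_plus_r (X : NormedModule C_AbsRing) (ip : X -> X -> C) (hip : is_inner_product ip) x y z :
  ip z (plus x y) = Cplus (ip z x) (ip z y).
Proof. rewrite (inner_conj hip), (ip_plus_l hip), Cplus_conj, <- !(inner_conj hip). reflexivity. Qed.

Lemma ip_scal_r (X : NormedModule C_AbsRing) (ip : X -> X -> C) (hip : is_inner_product ip) (a : C) x z :
  ip z (scal a x) = Cmult (Cconj a) (ip z x).
Proof. rewrite (inner_conj hip), (ip_scal_l hip), Cmult_conj, <- (inner_conj hip). reflexivity. Qed.

Lemma ip_minus_l (X : NormedModule C_AbsRing) (ip : X -> X -> C) (hip : is_inner_product ip) x y z :
  ip (minus x y) z = Cminus (ip x z) (ip y z).
Proof.
  replace (minus x y) with (plus x (scal (Copp 1) y)) by vec.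
  rewrite (ip_plus_l hip), (ip_scal_l hip). ring.
Qed.

Lemma ip_zero_l (X : NormedModule C_AbsRing) (ip : X -> X -> C) (hip : is_inner_product ip) z :
  ip zero z = RtoC 0.
Proof.
  replace (@zero X) with (minus z z) by vec. rewrite (ip_minus_l hip). ring.
Qed.

Lemma ip_zero_r (X : NormedModule C_AbsRing) (ip : X -> X -> C) (hip : is_inner_product ip) z :
  ip z zero = RtoC 0.
Proof. rewrite (inner_conj hip), (ip_zero_l hip). apply injective_projections; simpl; ring. Qed.

Lemma ip_sym0 (X : NormedModule C_AbsRing) (ip : X -> X -> C) (hip : is_inner_product ip) x y :
  ip x y = RtoC 0 -> ip y x = RtoC 0.
Proof. intros h. rewrite (inner_conj hip), h. apply injective_projections; simpl; ring. Qed.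

Lemma ip_eq0 (X : NormedModule C_AbsRing) (ip : X -> X -> C) (hip : is_inner_product ip) x :
  ip x x = RtoC 0 -> x = zero.
Proof.
  rewrite (inner_norm hip). intros h. apply RtoC_inj in h.
  apply norm_eq_zero. assert (t := norm_ge_0 x). nra.
Qed.

Lemma ip_one (X : NormedModule C_AbsRing) (ip : X -> X -> C) (hip : is_inner_product ip) x :
  ip x x = RtoC 1 -> norm x = 1.
Proof.
  rewrite (inner_norm hip). intros h. apply RtoC_inj in h.
  assert (t := norm_ge_0 x). nra.
Qed.

Lemma pythagoras (X : NormedModule C_AbsRing) (ip : X -> X -> C) (hip : is_inner_product ip) x y :
  ip x y = RtoC 0 -> norm (plus x y) ^ 2 = norm x ^ 2 + norm y ^ 2.
Proof.
  intros h. apply RtoC_inj. rewrite RtoC_plus, <- !(inner_norm hip).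
  rewrite (ip_plus_l hip), !(ip_plus_r hip), h, (ip_sym0 hip h). ring.
Qed.

(** The Cauchy-Schwarz inequality against a unit vector. *)
Lemma cauchy_schwarz_unit (X : NormedModule C_AbsRing) (ip : X -> X -> C) (hip : is_inner_product ip) x e :
  ip e e = RtoC 1 -> Cmod (ip x e) <= norm x.
Proof.
  intros he.
  assert (P : norm (plus (minus x (scal (ip x e) e)) (scal (ip x e) e)) ^ 2 =
     norm (minus x (scal (ip x e) e)) ^ 2 + norm (scal (ip x e) e) ^ 2).
  { apply (pythagoras hip).
    rewrite (ip_scal_r hip), (ip_minus_l hip), (ip_scal_l hip), he. ring. }
  replace (plus (minus x (scal (ip x e) e)) (scal (ip x e) e)) with x in P by vec.
  rewrite norm_scal_C, (ip_one hip he), Rmult_1_r in P.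
  assert (a := norm_ge_0 x). assert (b := Cmod_ge_0 (ip x e)).
  assert (c := pow2_ge_0 (norm (minus x (scal (ip x e) e)))). nra.
Qed.

(** Orthonormal families in which zero vectors are allowed, so that finite
    families are also indexed by [nat]. *)
Definition orthonormal (X : NormedModule C_AbsRing) (ip : X -> X -> C) (e : nat -> X) : Prop :=
  (forall i j, i <> j -> ip (e i) (e j) = RtoC 0) /\
  (forall i, ip (e i) (e i) = RtoC 1 \/ e i = zero).

Lemma lin_comb_orth (X : NormedModule C_AbsRing) (ip : X -> X -> C) (hip : is_inner_product ip) n c e y :
  (forall i, (i < n)%nat -> ip (e i) y = RtoC 0) -> ip (lin_comb n c e) y = RtoC 0.
Proof.
  induction n as [|n IH]; intros h; simpl.
  - apply (ip_zero_l hip).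
  - rewrite (ip_plus_l hip), (ip_scal_l hip), IH, h by auto. ring.
Qed.

Lemma lin_comb_coord (X : NormedModule C_AbsRing) (ip : X -> X -> C) (hip : is_inner_product ip) n c e j :
  (forall i k, (i < n)%nat -> (k < n)%nat -> i <> k -> ip (e i) (e k) = RtoC 0) -> (j < n)%nat ->
  ip (lin_comb n c e) (e j) = Cmult (c j) (ip (e j) (e j)).
Proof.
  induction n as [|n IH]; intros h hj; [lia|]; simpl.
  rewrite (ip_plus_l hip), (ip_scal_l hip).
  destruct (Nat.eq_dec j n) as [->|hne].
  - rewrite (lin_comb_orth hip). ring. intros i hi. apply h; lia.
  - rewrite IH by (auto; lia). rewrite (h n j) by lia. ring.
Qed.

(** If [e i] is zero, both sides vanish. *)
Lemma orthonormal_coord (X : NormedModule C_AbsRing) (ip : X -> X -> C) (hip : is_inner_product ip) e y i :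
  orthonormal ip e -> Cmult (ip y (e i)) (ip (e i) (e i)) = ip y (e i).
Proof.
  intros [_ h]. destruct (h i) as [->| ->]; [ring|]. rewrite !(ip_zero_r hip). ring.
Qed.

(** Bessel's inequality. *)
Lemma bessel (X : NormedModule C_AbsRing) (ip : X -> X -> C) (hip : is_inner_product ip) e y n :
  orthonormal ip e -> norm (lin_comb n (fun i => ip y (e i)) e) <= norm y.
Proof.
  intros he. set (s := lin_comb n (fun i => ip y (e i)) e).
  assert (P : norm (plus s (minus y s)) ^ 2 = norm s ^ 2 + norm (minus y s) ^ 2).
  { apply (pythagoras hip). apply (lin_comb_orth hip). intros i hi.
    apply (ip_sym0 hip). rewrite (ip_minus_l hip). unfold s.
    rewrite (lin_comb_coord hip) by (intros; auto; now apply he).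
    rewrite (orthonormal_coord hip) by auto. ring. }
  replace (plus s (minus y s)) with y in P by vec.
  assert (a := norm_ge_0 y). assert (b := norm_ge_0 s).
  assert (c := pow2_ge_0 (norm (minus y s))). nra.
Qed.

Lemma orthonormal_step (X : NormedModule C_AbsRing) (ip : X -> X -> C) (hip : is_inner_product ip) e c n :
  orthonormal ip e ->
  norm (lin_comb (S n) c e) ^ 2 = norm (lin_comb n c e) ^ 2 + (Cmod (c n) * norm (e n)) ^ 2.
Proof.
  intros he. simpl lin_comb. rewrite (pythagoras hip).
  - rewrite norm_scal_C. reflexivity.
  - apply (lin_comb_orth hip). intros i hi. rewrite (ip_scal_r hip), (proj1 he) by lia. ring.
Qed.

Lemma norm_lin_comb_eq (X Y : NormedModule C_AbsRing) (ipX : X -> X -> C) (ipY : Y -> Y -> C)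
  (hX : is_inner_product ipX) (hY : is_inner_product ipY) e f c n :
  orthonormal ipX e -> orthonormal ipY f -> (forall i, norm (e i) = norm (f i)) ->
  norm (lin_comb n c e) = norm (lin_comb n c f).
Proof.
  intros he hf hn.
  assert (E : norm (lin_comb n c e) ^ 2 = norm (lin_comb n c f) ^ 2).
  { induction n as [|n IH]; [simpl; now rewrite !norm_zero|].
    rewrite (orthonormal_step hX c n he), (orthonormal_step hY c n hf), IH, hn. reflexivity. }
  assert (a := norm_ge_0 (lin_comb n c e)). assert (b := norm_ge_0 (lin_comb n c f)). nra.
Qed.

(** The increment of the partial sums is orthogonal to the earlier sum. *)
Lemma orthonormal_incr (X : NormedModule C_AbsRing) (ip : X -> X -> C) (hip : is_inner_product ip) e c n k :
  orthonormal ip e ->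
  norm (minus (lin_comb (k + n) c e) (lin_comb n c e)) ^ 2
  = norm (lin_comb (k + n) c e) ^ 2 - norm (lin_comb n c e) ^ 2.
Proof.
  intros he. induction k as [|k IH].
  - change (0 + n)%nat with n. rewrite norm_minus_self. ring.
  - change (S k + n)%nat with (S (k + n)). rewrite (orthonormal_step hip c (k + n) he).
    simpl lin_comb.
    set (s := lin_comb (k + n) c e) in *. set (s0 := lin_comb n c e) in *.
    replace (minus (plus s (scal (c (k + n)%nat) (e (k + n)%nat))) s0) with
      (plus (minus s s0) (scal (c (k + n)%nat) (e (k + n)%nat))) by vec.
    rewrite (pythagoras hip).
    + rewrite IH, norm_scal_C. ring.
    + rewrite (ip_minus_l hip). unfold s, s0. rewrite !(lin_comb_orth hip); [ring| |];
      intros i hi; rewrite (ip_scal_r hip), (proj1 he) by lia; ring.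
Qed.

(** Riesz-Fischer: an orthogonal series with bounded partial sums converges,
    since the squared norms of these form a bounded increasing sequence. *)
Lemma orthonormal_series (X : NormedModule C_AbsRing) (ip : X -> X -> C) (hip : is_inner_product ip) e c M :
  banach X -> orthonormal ip e -> (forall n, norm (lin_comb n c e) <= M) ->
  exists l, cvg (fun n => lin_comb n c e) l.
Proof.
  intros bX he hM. apply bX. intros eps heps.
  set (a := fun n => norm (lin_comb n c e) ^ 2).
  assert (ag : Un_growing a).
  { intros n. unfold a. rewrite (orthonormal_step hip c n he).
    assert (t := pow2_ge_0 (Cmod (c n) * norm (e n))). lra. }
  assert (ac : Cauchy_crit a).
  { apply CV_Cauchy. destruct (growing_cv a ag) as [l hl]; [|exists l; exact hl].
    exists (M ^ 2). intros x [i ->]. unfold a. specialize (hM i).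
    assert (t := norm_ge_0 (lin_comb i c e)). nra. }
  destruct (ac (eps ^ 2)) as [N hN]; [nra|].
  assert (H : forall n m, (N <= n)%nat -> (n <= m)%nat ->
    norm (minus (lin_comb m c e) (lin_comb n c e)) < eps).
  { intros n m hn hm. assert (t := orthonormal_incr hip c n (m - n) he).
    replace (m - n + n)%nat with m in t by lia.
    specialize (hN m n ltac:(lia) ltac:(lia)). unfold Rdist in hN.
    assert (t' := Rle_abs (a m - a n)). unfold a in t', hN.
    assert (b := norm_ge_0 (minus (lin_comb m c e) (lin_comb n c e))).
    apply Rnot_le_lt. intros hle. nra. }
  exists N. intros n m hn hm.
  destruct (Nat.le_ge_cases n m); [rewrite norm_minus_sym|]; apply H; auto.
Qed.

(** The partial isometry taking the family [f] to the family [e], namely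
    [y |-> sum_i <y, f_i> e_i].  Its values lie in every closed subspace that
    contains the family [e]. *)
Lemma orthonormal_transfer (X Y : NormedModule C_AbsRing) (ipX : X -> X -> C) (ipY : Y -> Y -> C)
  (hX : is_inner_product ipX) (hY : is_inner_product ipY) e f :
  banach X -> orthonormal ipX e -> orthonormal ipY f -> (forall i, norm (e i) = norm (f i)) ->
  exists U : Y -> X, is_linear U /\ (forall y, norm (U y) <= norm y) /\
    (forall y i, ipX (U y) (e i) = ipY y (f i)) /\
    (forall S : subspace X, closed S -> (forall i, S (e i)) -> forall y, S (U y)).
Proof.
  intros bX he hf hn.
  assert (hb : forall y n, norm (lin_comb n (fun i => ipY y (f i)) e) <= norm y).
  { intros y n. rewrite (norm_lin_comb_eq hX hY _ n he hf hn). now apply bessel. }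
  assert (hl : forall y, exists l, cvg (fun n => lin_comb n (fun i => ipY y (f i)) e) l).
  { intros y. now apply (orthonormal_series hX (M := norm y)). }
  destruct (choice _ hl) as [U hU]. clear hl.
  assert (Ub : forall y, norm (U y) <= norm y).
  { intros y. replace (U y) with (minus (U y) zero) by vec.
    apply (cvg_norm_le (hU y)). exists O. intros n _.
    replace (minus (lin_comb n (fun i => ipY y (f i)) e) zero)
      with (lin_comb n (fun i => ipY y (f i)) e) by vec. apply hb. }
  exists U. split; [split|split; [|split]]; auto.
  - intros x y. apply (cvg_unique (hU (plus x y))).
    apply (cvg_ext (u := fun n => plus (lin_comb n (fun i => ipY x (f i)) e) (lin_comb n (fun i => ipY y (f i)) e))).
    + intros n. rewrite <- lin_comb_plus. apply lin_comb_ext; auto.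
      intros i _. now rewrite (ip_plus_l hY).
    + now apply cvg_plus.
  - intros k x. apply (cvg_unique (hU (scal k x))).
    apply (cvg_ext (u := fun n => scal (k : C) (lin_comb n (fun i => ipY x (f i)) e))).
    + intros n. rewrite <- lin_comb_scal. apply lin_comb_ext; auto.
      intros i _. symmetry. exact (ip_scal_l hY (k : C) x (f i)).
    + now apply cvg_scal.
  - exists 1. split; [lra|]. intros x. rewrite Rmult_1_l. auto.
  - intros y i. destruct (proj2 he i) as [h1|h0].
    2: { assert (f i = zero) as ->.
         { apply norm_eq_zero. rewrite <- hn, h0. apply norm_zero. }
         rewrite h0, (ip_zero_r hX), (ip_zero_r hY). reflexivity. }
    assert (E : Cmod (Cminus (ipX (U y) (e i)) (ipY y (f i))) = 0).
    2: { apply Cmod_eq_0 in E.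
         replace (ipX (U y) (e i)) with (Cplus (Cminus (ipX (U y) (e i)) (ipY y (f i))) (ipY y (f i))) by ring.
         rewrite E. ring. }
    apply Rle_antisym; [|apply Cmod_ge_0]. apply le_epsilon. intros eps heps.
    destruct (hU y eps heps) as [N hN].
    specialize (hN (N + S i)%nat ltac:(lia)).
    rewrite norm_minus_sym in hN.
    assert (t := cauchy_schwarz_unit hX
      (minus (U y) (lin_comb (N + S i) (fun i => ipY y (f i)) e)) h1).
    rewrite (ip_minus_l hX), (lin_comb_coord hX), h1, Cmult_1_r in t; [lra| |lia].
    intros; now apply he.
  - intros S cS hS y. apply (closed_cvg (u := fun n => lin_comb n (fun i => ipY y (f i)) e) cS); auto.
    intros n. apply lin_comb_in. auto.
Qed.

(** * Separability and orthonormal bases *)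

(** Existence of a norm-dense sequence. *)
Definition norm_separable (X : NormedModule C_AbsRing) : Prop :=
  exists u : nat -> X, forall x eps, 0 < eps -> exists n, norm (minus x (u n)) < eps.

Lemma norm_separable_of (X : NormedModule C_AbsRing) : separable X -> norm_separable X.
Proof.
  intros [u hu]. exists u. intros x eps heps.
  (* the interior of the norm ball of radius [eps] about [x]; norm balls need
     not be balls of the uniform structure *)
  destruct (hu (fun y => exists e, 0 < e /\ forall z, ball y e z -> norm (minus x z) < eps)) as [n [e [he hz]]].
  - intros y [e [he hz]]. exists (mkposreal (e / 2) ltac:(lra)). intros w hw.
    exists (e / 2). split; [lra|]. intros z hwz. apply hz.
    replace e with (e / 2 + e / 2) by field. exact (ball_triangle _ _ _ _ _ hw hwz).
  - exists x, (eps / norm_factor (V := X)). assert (t := norm_factor_pos X).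
    assert (p := Rdiv_lt_0_compat _ _ heps t). split; auto.
    intros z hz. apply (norm_compat2 (V := X) x z (mkposreal _ p)) in hz. simpl in hz.
    rewrite norm_minus_sym.
    replace eps with (norm_factor (V := X) * (eps / norm_factor (V := X))); [exact hz|].
    field. lra.
  - exists n. apply hz. exact (ball_center (u n) (mkposreal e he)).
Qed.

(** Subsets of a separable space are separable: for every pair [(k, m)], coded by
    an integer, choose a point of [S] at distance less than [1/(m+1)] from [v k]
    whenever there is one. *)
Lemma dense_in_subset (X : NormedModule C_AbsRing) (S : X -> Prop) :
  norm_separable X -> S zero -> exists u : nat -> X, (forall n, S (u n)) /\
    forall x eps, S x -> 0 < eps -> exists n, norm (minus x (u n)) < eps.
Proof.
  intros [v hv] h0.
  assert (H : forall n, exists y, S y /\ ((exists z, S z /\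
      norm (minus z (v (fst (Cantor.of_nat n)))) < / INR (1 + snd (Cantor.of_nat n))) ->
      norm (minus y (v (fst (Cantor.of_nat n)))) < / INR (1 + snd (Cantor.of_nat n)))).
  { intros n. destruct (classic (exists z, S z /\
      norm (minus z (v (fst (Cantor.of_nat n)))) < / INR (1 + snd (Cantor.of_nat n)))) as [[z [h1 h2]]|h].
    - exists z. auto.
    - exists zero. split; auto. intros; contradiction. }
  destruct (choice _ H) as [u hu]. exists u. split; [intros n; apply hu|].
  intros x eps hx heps.
  destruct (archimed_cor1 (eps / 2)) as [m [hm hm']]; [lra|].
  destruct m as [|m]; [lia|].
  change (Datatypes.S m) with (1 + m)%nat in hm.
  assert (p : 0 < / INR (1 + m)) by (apply Rinv_0_lt_compat, lt_0_INR; lia).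
  destruct (hv x (/ INR (1 + m)) p) as [k hk].
  exists (Cantor.to_nat (k, m)). destruct (hu (Cantor.to_nat (k, m))) as [_ h].
  rewrite Cantor.cancel_of_to in h. simpl fst in h; simpl snd in h.
  
  specialize (h (ex_intro _ x (conj hx hk))).
  assert (t := norm_minus_split x (v k) (u (Cantor.to_nat (k, m)))).
  rewrite (norm_minus_sym (v k) (u (Cantor.to_nat (k, m)))) in t. lra.
Qed.

Lemma norm_separable_sub (X : NormedModule C_AbsRing) (S : subspace X) :
  norm_separable X -> norm_separable (sub_NormedModule S).
Proof.
  intros hX. destruct (dense_in_subset (S := S) hX (sub_zero S)) as [u [hu hd]].
  exists (fun n => exist _ (u n) (hu n)). intros [x hx] eps heps. exact (hd x eps hx heps).
Qed.

(** Component of [x] orthogonal to the first [n] vectors of the orthonormal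
    family [e]. *)
Definition resid (X : NormedModule C_AbsRing) (ip : X -> X -> C) (n : nat) (e : nat -> X) (x : X) : X :=
  minus x (lin_comb n (fun i => ip x (e i)) e).

(** What the [n]-th vector [x] of the Gram-Schmidt process for [u] in [S] has to
    satisfy, given the previous ones: it is a unit vector of [S] orthogonal to
    them unless they already span [S], and [u n] lies in the span of [x] and of the
    previous vectors. *)
Definition gs_next (X : NormedModule C_AbsRing) (ip : X -> X -> C) (S : X -> Prop) (u : nat -> X)
  (n : nat) (e : nat -> X) (x : X) : Prop :=
  S x /\ (forall i, (i < n)%nat -> ip x (e i) = RtoC 0) /\
  (ip x x = RtoC 1 \/ x = zero /\ forall y, S y -> resid ip n e y = zero) /\
  exists a : C, resid ip n e (u n) = scal a x.

Lemma normalize (X : NormedModule C_AbsRing) (ip : X -> X -> C) (hip : is_inner_product ip) (r : X) :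
  r <> zero -> exists a b : C, ip (scal b r) (scal b r) = RtoC 1 /\ r = scal a (scal b r).
Proof.
  intros hr. assert (hn : norm r <> 0) by (intros E; apply hr; now apply norm_eq_zero).
  assert (hc : RtoC (norm r) <> 0) by (intros E; apply hn; now apply RtoC_inj).
  exists (RtoC (norm r)), (RtoC (/ norm r)). split.
  - rewrite (inner_norm hip), norm_scal_C, Cmod_R, Rabs_pos_eq.
    + f_equal. field. auto.
    + left. apply Rinv_0_lt_compat. assert (t := norm_ge_0 r). lra.
  - rewrite RtoC_inv by auto. vec. field. auto.
Qed.

Lemma resid_orth (X : NormedModule C_AbsRing) (ip : X -> X -> C) (hip : is_inner_product ip) n e x j :
  (forall i k, (i < n)%nat -> (k < n)%nat -> i <> k -> ip (e i) (e k) = RtoC 0) ->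
  (forall i, (i < n)%nat -> ip (e i) (e i) = RtoC 1 \/ e i = zero) ->
  (j < n)%nat -> ip (resid ip n e x) (e j) = RtoC 0.
Proof.
  intros ho hu hj. unfold resid. rewrite (ip_minus_l hip), (lin_comb_coord hip) by auto.
  destruct (hu j hj) as [->| ->]; [ring|]. rewrite !(ip_zero_r hip). ring.
Qed.

Lemma gs_next_exists (X : NormedModule C_AbsRing) (ip : X -> X -> C) (hip : is_inner_product ip)
  (S : subspace X) u n e :
  (forall k, S (u k)) -> (forall i, (i < n)%nat -> S (e i)) ->
  (forall i k, (i < n)%nat -> (k < n)%nat -> i <> k -> ip (e i) (e k) = RtoC 0) ->
  (forall i, (i < n)%nat -> ip (e i) (e i) = RtoC 1 \/ e i = zero) ->
  exists x, gs_next ip S u n e x.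
Proof.
  intros hu hS ho hn.
  assert (hr : forall y, S y -> S (resid ip n e y)).
  { intros y hy. unfold resid. apply sub_plus; auto. apply sub_opp. now apply lin_comb_in. }
  assert (main : forall y, S y -> resid ip n e y <> zero -> exists a x, resid ip n e y = scal a x /\
    S x /\ (forall i, (i < n)%nat -> ip x (e i) = RtoC 0) /\ ip x x = RtoC 1).
  { intros y hy h0. destruct (normalize hip h0) as [a [b [h1 h2]]].
    exists a, (scal b (resid ip n e y)). repeat split; auto.
    - apply sub_scal; auto.
    - intros i hi. rewrite (ip_scal_l hip), (resid_orth hip) by auto. ring. }
  destruct (classic (resid ip n e (u n) = zero)) as [E|E].
  - destruct (classic (exists y, S y /\ resid ip n e y <> zero)) as [[y [hy hy0]]|hno].
    + destruct (main y hy hy0) as [a [x [h1 [h2 [h3 h4]]]]]. exists x. repeat split; auto.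
      exists (RtoC 0). rewrite E. vec.
    + exists zero. split; [apply sub_zero|split; [|split]].
      * intros; apply (ip_zero_l hip).
      * right. split; auto. intros y hy. apply NNPP. intros h. apply hno. eauto.
      * exists (RtoC 0). rewrite E. vec.
  - destruct (main (u n) (hu n) E) as [a [x [h1 [h2 [h3 h4]]]]]. exists x. repeat split; eauto.
Qed.

Lemma gs_next_ext (X : NormedModule C_AbsRing) (ip : X -> X -> C) (S : X -> Prop) u n e e' x :
  (forall i, (i < n)%nat -> e i = e' i) -> gs_next ip S u n e x -> gs_next ip S u n e' x.
Proof.
  intros E [h1 [h2 [h3 h4]]].
  assert (R : forall y, resid ip n e y = resid ip n e' y).
  { intros y. unfold resid. f_equal. apply lin_comb_ext; auto. intros i hi. now rewrite E. }
  split; [|split; [|split]]; auto.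
  - intros i hi. rewrite <- E by auto. auto.
  - destruct h3 as [h3|[h3 h5]]; auto. right. split; auto. intros y hy. rewrite <- R. auto.
  - rewrite <- R. auto.
Qed.

(** The Gram-Schmidt process without holes: when [u n] is in the span of the
    previous vectors, any unit vector of [S] orthogonal to these is taken, and
    zero only when they span [S].  The last property says that [u n] is in the
    span of [e 0], ..., [e n]. *)
Lemma gram_schmidt (X : NormedModule C_AbsRing) (ip : X -> X -> C) (hip : is_inner_product ip)
  (S : subspace X) u :
  (forall k, S (u k)) ->
  exists e, orthonormal ip e /\ (forall n, S (e n)) /\
    (forall n, e n = zero -> forall y, S y -> resid ip n e y = zero) /\
    (forall n y, (forall i, (i <= n)%nat -> ip y (e i) = RtoC 0) -> ip y (u n) = RtoC 0).
Proof.
  intros hu.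
  assert (P : forall (p : nat * (nat -> X)), exists x,
    (exists x', gs_next ip S u (fst p) (snd p) x') -> gs_next ip S u (fst p) (snd p) x).
  { intros p. destruct (classic (exists x', gs_next ip S u (fst p) (snd p) x')) as [[x hx]|h].
    - exists x; auto.
    - exists zero; intros; contradiction. }
  destruct (choice _ P) as [pick hpick]. clear P.
  (* [st n] holds the first [n] vectors, later entries being irrelevant *)
  set (st := fix st (n : nat) : nat -> X := match n with
     | O => fun _ => zero
     | Datatypes.S m => fun i => if Nat.eqb i m then pick (m, st m) else st m i end).
  set (e := fun n => pick (n, st n)).
  assert (hst : forall n i, (i < n)%nat -> st n i = e i).
  { induction n as [|n IH]; intros i hi; [lia|]. simpl.
    destruct (Nat.eqb_spec i n) as [->|h]; [reflexivity|]. apply IH. lia. }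
  assert (G : forall n, gs_next ip S u n e (e n)).
  { intros n. induction n as [n IH] using lt_wf_ind.
    apply (gs_next_ext (e := st n)); [now apply hst|].
    apply (hpick (n, st n)). simpl.
    destruct (gs_next_exists hip (S := S) (u := u) (n := n) (e := e)) as [x hx]; auto.
    - intros i hi. now apply IH.
    - intros i k hi hk hik. destruct (Nat.lt_total i k) as [h|[h|h]]; [|lia|].
      + apply (ip_sym0 hip). destruct (IH k hk) as [_ [h' _]]. auto.
      + destruct (IH i hi) as [_ [h' _]]. auto.
    - intros i hi. destruct (IH i hi) as [_ [_ [[h|[h _]] _]]]; auto.
    - exists x. apply (gs_next_ext (e := e)); auto. intros i hi. symmetry. now apply hst. }
  assert (O : orthonormal ip e).
  { split.
    - intros i j hij. destruct (Nat.lt_total i j) as [h|[h|h]]; [|lia|].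
      + apply (ip_sym0 hip). destruct (G j) as [_ [h' _]]. auto.
      + destruct (G i) as [_ [h' _]]. auto.
    - intros i. destruct (G i) as [_ [_ [[h|[h _]] _]]]; auto. }
  exists e. split; [exact O|split; [|split]].
  - intros n. apply G.
  - intros n h0 y hy. destruct (G n) as [_ [_ [[h|[_ h]] _]]]; auto.
    rewrite h0, (ip_zero_l hip) in h. apply RtoC_inj in h. lra.
  - intros n y hy. destruct (G n) as [_ [_ [_ [a ha]]]].
    replace (u n) with (plus (resid ip n e (u n)) (lin_comb n (fun i => ip (u n) (e i)) e))
      by (unfold resid; vec).
    rewrite ha, (ip_plus_r hip), (ip_scal_r hip), hy by auto.
    rewrite (ip_sym0 hip (x := lin_comb n (fun i => ip (u n) (e i)) e)); [ring|].
    apply (lin_comb_orth hip). intros i hi. apply (ip_sym0 hip). apply hy. lia.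
Qed.

(** Orthonormal bases of a subspace, in the Hilbert space sense: the family is
    total.  Zero vectors are allowed as in [orthonormal]. *)
Definition orthonormal_basis (X : NormedModule C_AbsRing) (ip : X -> X -> C) (S : subspace X)
  (e : nat -> X) : Prop :=
  orthonormal ip e /\ (forall n, S (e n)) /\
  (forall y, S y -> (forall i, ip y (e i) = RtoC 0) -> y = zero).

Lemma resid_zero_basis (X : NormedModule C_AbsRing) (ip : X -> X -> C) (hip : is_inner_product ip)
  (S : subspace X) e n :
  orthonormal ip e -> (forall i, S (e i)) -> (forall i, (i < n)%nat -> e i <> zero) ->
  (forall y, S y -> resid ip n e y = zero) ->
  is_quotient_basis S (fun x => x = zero) n e.
Proof.
  intros he hS h0 hr. split; [auto|split].
  - intros y hy. eexists. exact (hr y hy).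
  - intros c hc i hi. assert (t := lin_comb_coord hip c (n := n) (e := e) (j := i)).
    rewrite hc, (ip_zero_l hip) in t.
    destruct (proj2 he i) as [h1|h1]; [|now apply h0 in h1].
    rewrite h1, Cmult_1_r in t. symmetry. apply t; auto. intros; now apply he.
Qed.

Lemma first_zero (X : NormedModule C_AbsRing) (e : nat -> X) n :
  e n = zero -> exists m, (m <= n)%nat /\ e m = zero /\ forall i, (i < m)%nat -> e i <> zero.
Proof.
  induction n as [n IH] using lt_wf_ind. intros hn.
  destruct (classic (exists i, (i < n)%nat /\ e i = zero)) as [[i [hi h0]]|h].
  - destruct (IH i hi h0) as [m [h1 h2]]. exists m. split; [lia|auto].
  - exists n. split; [lia|split; auto]. intros i hi E. apply h. eauto.
Qed.

(** Gram-Schmidt on a dense sequence of [S]: a vanishing vector would make the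
    previous ones a finite basis. *)
Lemma orthonormal_basis_separable (X : NormedModule C_AbsRing) (ip : X -> X -> C)
  (hip : is_inner_product ip) (S : subspace X) :
  norm_separable X -> exists e, orthonormal_basis ip S e /\
    ((forall n, ~ has_basis S (fun x => x = zero) n) -> forall i, norm (e i) = 1).
Proof.
  intros sX. destruct (dense_in_subset (S := S) sX (sub_zero S)) as [u [hu hd]].
  destruct (gram_schmidt hip hu) as [e [he [hS [h0 hc]]]].
  exists e. split; [split; [auto|split; auto]|].
  - intros y hy hye. apply norm_eq_zero. apply Rle_antisym; [|apply norm_ge_0].
    apply le_epsilon. intros eps heps. destruct (hd y eps hy heps) as [n hn].
    assert (E := pythagoras hip (x := y) (y := scal (Copp 1) (u n))).
    rewrite norm_scal_C in E.
    replace (plus y (scal (Copp 1) (u n))) with (minus y (u n)) in E by vec.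
    assert (t : norm (minus y (u n)) ^ 2 >= norm y ^ 2).
    { rewrite E. assert (t := pow2_ge_0 (Cmod (Copp 1) * norm (u n))). lra.
      rewrite (ip_scal_r hip), (hc n y) by auto. ring. }
    assert (a := norm_ge_0 (minus y (u n))). assert (b := norm_ge_0 y). nra.
  - intros hinf i. destruct (proj2 he i) as [h1|h1]; [now apply (ip_one hip)|].
    exfalso. destruct (first_zero h1) as [m [_ [hm hlt]]]. apply (hinf m). exists e.
    apply (resid_zero_basis hip); auto.
Qed.

(** Gram-Schmidt on a finite basis of [S]: the first zero occurs at index [n], as
    the vectors before it form a basis. *)
Lemma orthonormal_basis_finite (X : NormedModule C_AbsRing) (ip : X -> X -> C)
  (hip : is_inner_product ip) (S : subspace X) n :
  has_basis S (fun x => x = zero) n -> exists e, orthonormal_basis ip S e /\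
    forall i, norm (e i) = if Nat.ltb i n then 1 else 0.
Proof.
  intros [f hf]. assert (hf' := hf). destruct hf' as [fS [fs fi]].
  set (u := fun k => if Nat.ltb k n then f k else zero).
  assert (hu : forall k, S (u k)).
  { intros k. unfold u. destruct (Nat.ltb_spec k n); [auto|apply sub_zero]. }
  destruct (gram_schmidt hip hu) as [e [he [hS [h0 hc]]]].
  (* the first [n] vectors are already total, since they span the basis [f] *)
  assert (comp : forall y, S y -> (forall i, (i < n)%nat -> ip y (e i) = RtoC 0) -> y = zero).
  { intros y hy hye. destruct (fs y hy) as [c hyc].
    assert (E : y = lin_comb n c f).
    { replace y with (plus (lin_comb n c f) (minus y (lin_comb n c f))) by vec. rewrite hyc. vec. }
    apply (ip_eq0 hip). rewrite E at 1. apply (lin_comb_orth hip). intros k hk.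
    apply (ip_sym0 hip).
    assert (t : ip y (u k) = RtoC 0) by (apply (hc k); intros i hi; apply hye; lia).
    unfold u in t. destruct (Nat.ltb_spec k n); [auto|lia]. }
  exists e. split.
  - split; [auto|split; auto].
  - intros i. destruct (Nat.ltb_spec i n) as [hi|hi].
    + destruct (proj2 he i) as [h1|h1]; [now apply (ip_one hip)|].
      exfalso. destruct (first_zero h1) as [m [hle [hm hlt]]].
      assert (m = n); [|lia].
      apply (basis_size (V := S) (e := e) (f := f)); auto. apply (resid_zero_basis hip); auto.
    + rewrite (comp (e i)); [apply norm_zero|auto|]. intros j hj. apply he. lia.
Qed.

(** Equidimensional subspaces of separable spaces have orthonormal bases
    indexed by the same set. *)
Lemma matching_orthonormal_bases (X Y : NormedModule C_AbsRing) (ipX : X -> X -> C) (ipY : Y -> Y -> C)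
  (hX : is_inner_product ipX) (hY : is_inner_product ipY) (E : subspace X) (F : subspace Y) :
  norm_separable X -> norm_separable Y ->
  equidim E (fun x => x = zero) F (fun x => x = zero) ->
  exists e f, orthonormal_basis ipX E e /\ orthonormal_basis ipY F f /\
    forall i, norm (e i) = norm (f i).
Proof.
  intros sX sY [[n [hE hF]]|[hE hF]].
  - destruct (orthonormal_basis_finite hX hE) as [e [he hne]].
    destruct (orthonormal_basis_finite hY hF) as [f [hf hnf]].
    exists e, f. split; [auto|split; auto]. intros i. now rewrite hne, hnf.
  - destruct (orthonormal_basis_separable hX E sX) as [e [he hne]].
    destruct (orthonormal_basis_separable hY F sY) as [f [hf hnf]].
    exists e, f. split; [auto|split; auto]. intros i. now rewrite hne, hnf.
Qed.

(** * Completing a bounded below and a surjective operator *)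

Lemma is_linear_add (X Y : NormedModule C_AbsRing) (S T : X -> Y) :
  is_linear S -> is_linear T -> is_linear (fun x => plus (S x) (T x)).
Proof.
  intros hS hT. apply (is_linear_comp (fun x => (S x, T x)) (fun p : Y * Y => plus (fst p) (snd p))).
  - now apply is_linear_prod.
  - apply is_linear_plus.
Qed.

Lemma is_linear_cscal (X Y : NormedModule C_AbsRing) (c : C) (T : X -> Y) :
  is_linear T -> is_linear (fun x => scal c (T x)).
Proof.
  intros hT. apply (is_linear_comp T (fun y : Y => scal c y)); auto.
  apply (is_linear_scal_r (K := C_AbsRing)). intros a b; exact (Cmult_comm a b).
Qed.

Lemma is_linear_sub (X Y : NormedModule C_AbsRing) (S T : X -> Y) :
  is_linear S -> is_linear T -> is_linear (fun x => minus (S x) (T x)).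
Proof.
  intros hS hT. apply (is_linear_ext (fun x => plus (S x) (scal (Copp 1) (T x)))).
  - intros x. vec.
  - apply is_linear_add; auto. now apply is_linear_cscal.
Qed.

Lemma is_linear_shift (X : NormedModule C_AbsRing) (T : X -> X) (lambda : C) :
  is_linear T -> is_linear (shift T lambda).
Proof.
  intros hT. apply is_linear_sub; auto.
  apply (is_linear_cscal lambda (T := fun x : X => x)). apply is_linear_id.
Qed.

Lemma is_linear_upper (X Y : NormedModule C_AbsRing) (A : X -> X) (U : Y -> X) (B : Y -> Y) :
  is_linear A -> is_linear U -> is_linear B -> is_linear (upper_triangular A U B).
Proof.
  intros hA hU hB.
  apply (is_linear_prod (T := prod_NormedModule C_AbsRing X Y)
    (fun p => plus (A (fst p)) (U (snd p))) (fun p => B (snd p))).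
  - apply (is_linear_add (X := prod_NormedModule C_AbsRing X Y)).
    + apply (is_linear_comp (U := prod_NormedModule C_AbsRing X Y) fst A); auto. apply is_linear_fst.
    + apply (is_linear_comp (U := prod_NormedModule C_AbsRing X Y) snd U); auto. apply is_linear_snd.
  - apply (is_linear_comp (U := prod_NormedModule C_AbsRing X Y) snd B); auto. apply is_linear_snd.
Qed.

Lemma closed_of_cvg (X : NormedModule C_AbsRing) (S : X -> Prop) :
  (forall u l, (forall n, S (u n)) -> cvg u l -> S l) -> closed S.
Proof.
  intros h x hx. assert (pf := norm_factor_pos X).
  assert (H : forall n, exists y, S y /\ norm (minus y x) < (/2) ^ n).
  { intros n. apply NNPP. intros hn. apply hx.
    assert (p : 0 < (/2)^n / norm_factor (V := X)).
    { apply Rdiv_lt_0_compat; auto. apply pow_lt; lra. }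
    exists (mkposreal _ p). intros y hy hS. apply hn. exists y. split; auto.
    apply (norm_compat2 (V := X)) in hy. simpl in hy.
    replace ((/2)^n) with (norm_factor (V := X) * ((/2)^n / norm_factor (V := X))) by (field; lra).
    exact hy. }
  destruct (choice _ H) as [u hu]. apply (h u); [apply hu|].
  intros eps heps. destruct (pow_half_small 1 heps) as [N hN]. exists N. intros n hn.
  specialize (hN n hn). destruct (hu n) as [_ t]. lra.
Qed.

Lemma closed_kernel (X : NormedModule C_AbsRing) (T : X -> X) :
  is_linear T -> closed (kernel T).
Proof.
  intros lT. apply closed_of_cvg. intros u l hu hl. unfold kernel in *.
  apply (cvg_unique (u := fun n => T (u n))); [now apply cvg_linear|].
  intros eps heps. exists O. intros n _. rewrite hu, norm_minus_self. auto.
Qed.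

Lemma closed_range (X : NormedModule C_AbsRing) (T : X -> X) c :
  banach X -> is_linear T -> 0 < c -> (forall x, c * norm x <= norm (T x)) -> closed (range T).
Proof.
  intros bX lT hc hb. apply closed_of_cvg. intros u l hu hl.
  destruct (choice _ hu) as [x hx].
  destruct (bX x) as [k hk].
  - intros eps heps. destruct (hl (c * eps / 2)) as [N hN]; [nra|]. exists N. intros n m hn hm.
    specialize (hb (minus (x n) (x m))). rewrite (lin_minus lT), !hx in hb.
    assert (t := norm_minus_split (u n) l (u m)). rewrite (norm_minus_sym l (u m)) in t.
    assert (t1 := hN n hn). assert (t2 := hN m hm). nra.
  - exists k. apply (cvg_unique (u := fun n => T (x n))); [now apply cvg_linear|].
    apply (cvg_ext (u := u)); auto.
Qed.

(** A contractive projection onto a closed subspace; only that is needed, not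
    the orthogonality of its kernel. *)
Lemma orthogonal_projection (X : NormedModule C_AbsRing) (ip : X -> X -> C)
  (hip : is_inner_product ip) (S : subspace X) :
  banach X -> norm_separable X -> closed S ->
  exists P : X -> X, is_linear P /\ (forall x, norm (P x) <= norm x) /\
    (forall x, S (P x)) /\ (forall x, S x -> P x = x).
Proof.
  intros bX sX cS. destruct (orthonormal_basis_separable hip S sX) as [r [[hr [hrS hrc]] _]].
  destruct (orthonormal_transfer hip hip bX hr hr) as [P [lP [bP [cP inP]]]]; auto.
  exists P. split; [auto|split; [auto|split]].
  - apply inP; auto.
  - intros x hx. replace x with (minus (P x) (minus (P x) x)) at 2 by vec.
    rewrite (hrc (minus (P x) x)); [vec| |].
    + apply sub_plus; [apply inP; auto|now apply sub_opp].
    + intros i. rewrite (ip_minus_l hip), cP. ring.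
Qed.

(** If [A] is bounded below, [B] is onto and the codimension of the range of [A]
    is the dimension of the kernel of [B], a partial isometry from the kernel
    of [B] onto a complement of the range of [A] completes them to a bijective
    operator matrix; the bound of its inverse only depends on the bounds for
    [A] and [B]. *)
Lemma completion (X Y : NormedModule C_AbsRing) (ipX : X -> X -> C) (ipY : Y -> Y -> C)
  (hX : is_inner_product ipX) (hY : is_inner_product ipY)
  (A : X -> X) (B : Y -> Y) (lA : is_linear A) (lB : is_linear B) (c m : R) :
  banach X -> banach Y -> norm_separable X -> norm_separable Y ->
  0 < c -> (forall x, c * norm x <= norm (A x)) ->
  0 < m -> (forall y, exists x, B x = y /\ norm x <= m * norm y) ->
  equidim (fun _ => True) (range A) (kernel B) (fun y => y = zero) ->
  exists U : Y -> X, is_linear U /\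
    (forall p, upper_triangular A U B p = zero -> p = zero) /\
    (forall q : prod_NormedModule C_AbsRing X Y,
       exists p : prod_NormedModule C_AbsRing X Y, upper_triangular A U B p = q /\
         norm p <= (/ c + 2 + 2 * m) * norm q).
Proof.
  intros bX bY sX sY hc hA hm hB hdim.
  destruct (orthogonal_projection hX (S := range_sub lA) bX sX) as [P [lP [bP [rP idP]]]].
  { now apply (closed_range (c := c)). }
  assert (lQ : is_linear (fun x => minus x (P x))).
  { apply (is_linear_sub (S := fun x : X => x)); auto. apply is_linear_id. }
  (* [E] is a complement of the range of [A], [F] the kernel of [B]; below, [U]
     maps [F] onto [E] isometrically and [D] is its adjoint *)
  set (E := kernel_sub lP). set (F := kernel_sub lB).
  assert (cE : closed E) by now apply closed_kernel.
  assert (cF : closed F) by now apply closed_kernel.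
  destruct (matching_orthonormal_bases hX hY (E := E) (F := F) sX sY) as [e [f [he [hf hn]]]].
  { apply (equidim_map (V := fun _ : X => True) (W := range A) (V' := kernel B) (W' := fun y : Y => y = zero)); [|tauto|auto].
    intros n. split.
    - apply (has_basis_map (phi := fun x => minus x (P x)) (psi := fun x => x)
        (V := full_sub X) (W := range_sub lA) (V' := E) (W' := zero_sub X)); auto.
      + apply is_linear_id.
      + intros x _. change (P (minus x (P x)) = zero). rewrite (lin_minus lP), (idP (P x)) by auto. vec.
      + exact (fun _ _ => I).
      + intros x hx. change (minus x (P x) = zero). rewrite idP by auto. vec.
      + intros y hy. rewrite hy. apply sub_zero.
      + intros x _. replace (minus x (minus x (P x))) with (P x) by vec. apply rP.
      + intros y hy. change (minus y (minus y (P y)) = zero).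
        change (P y = zero) in hy. rewrite hy. vec.
    - apply (has_basis_map (phi := fun x => x) (psi := fun x => minus x (P x))
        (V := E) (W := zero_sub X) (V' := full_sub X) (W' := range_sub lA)); auto.
      + apply is_linear_id.
      + exact (fun _ _ => I).
      + intros x _. change (P (minus x (P x)) = zero). rewrite (lin_minus lP), (idP (P x)) by auto. vec.
      + intros y hy. rewrite hy. apply sub_zero.
      + intros x hx. change (minus x (P x) = zero). rewrite idP by auto. vec.
      + intros y hy. change (minus y (minus y (P y)) = zero).
        change (P y = zero) in hy. rewrite hy. vec.
      + intros x _. replace (minus x (minus x (P x))) with (P x) by vec. apply rP. }
  destruct he as [he [heE hec]]. destruct hf as [hf [hfF hfc]].
  destruct (orthonormal_transfer hX hY bX he hf hn) as [U [lU [bU [cU inU]]]].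
  destruct (orthonormal_transfer hY hX bY hf he (fun i => eq_sym (hn i))) as [D [lD [bD [cD inD]]]].
  assert (UE : forall y, P (U y) = zero) by exact (inU E cE heE).
  assert (DF : forall x, B (D x) = zero) by exact (inD F cF hfF).
  assert (UD : forall x, P x = zero -> U (D x) = x).
  { intros x hx. replace x with (minus (U (D x)) (minus (U (D x)) x)) at 2 by vec.
    rewrite (hec (minus (U (D x)) x)); [vec| |].
    - change (P (minus (U (D x)) x) = zero). rewrite (lin_minus lP), UE, hx. vec.
    - intros i. rewrite (ip_minus_l hX), cU, cD. ring. }
  exists U. split; [auto|split].
  - intros [x y] E0. injection E0 as E1 E2; simpl in E1, E2.
    change (plus (A x) (U y) = (@zero X)) in E1. change (B y = (@zero Y)) in E2.
    assert (Ax : A x = zero).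
    { replace (A x) with (P (plus (A x) (U y))).
      - rewrite E1. apply (lin_zero lP).
      - rewrite (lin_plus lP), UE, (idP (A x)); [vec|]. exists x; auto. }
    assert (Uy : U y = zero) by (rewrite Ax in E1; rewrite <- E1; vec).
    assert (y = zero) as ->.
    { apply hfc; [exact E2|]. intros i. rewrite <- cU, Uy. apply (ip_zero_l hX). }
    assert (x = zero) as ->; [|reflexivity].
    apply norm_eq_zero. specialize (hA x). rewrite Ax, norm_zero in hA.
    assert (t := norm_ge_0 x). nra.
  - intros [u v].
    destruct (rP u) as [x hx]. destruct (hB v) as [y0 [hy0 ny0]].
    (* solve [B y0 = v] and [A x = P u]; the defect [g] of the first row lies in
       [E] and is corrected by adding [D g], which [B] annihilates, to [y0] *)
    set (g := minus (minus u (P u)) (U y0)).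
    assert (Pg : P g = zero).
    { unfold g. rewrite !(lin_minus lP), UE, (idP (P u)) by auto. vec. }
    exists (x, plus y0 (D g)). split.
    + apply injective_projections; simpl.
      * rewrite (lin_plus lU), hx, (UD g Pg). unfold g. vec.
      * rewrite (lin_plus lB), DF, hy0. vec.
    + set (q := (u, v) : prod_NormedModule C_AbsRing X Y).
      assert (nu : norm u <= norm q) by exact (norm_fst_le q).
      assert (nv : norm v <= norm q) by exact (norm_snd_le q).
      eapply Rle_trans; [apply norm_prod_le|]. simpl.
      assert (n1 : norm x <= / c * norm u).
      { specialize (hA x). rewrite hx in hA. specialize (bP u).
        apply (Rmult_le_reg_l c); auto.
        replace (c * (/ c * norm u)) with (norm u) by (field; lra). lra. }
      assert (n2 : norm (plus y0 (D g)) <= 2 * norm u + 2 * (m * norm v)).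
      { eapply Rle_trans; [apply norm_triangle|].
        specialize (bD g). specialize (bU y0). specialize (bP u).
        assert (t1 := norm_minus_le (minus u (P u)) (U y0)).
        assert (t2 := norm_minus_le u (P u)). fold g in t1. lra. }
      assert (p1 : / c * norm u <= / c * norm q).
      { apply Rmult_le_compat_l; auto. left; now apply Rinv_0_lt_compat. }
      assert (p2 : m * norm v <= m * norm q) by (apply Rmult_le_compat_l; lra).
      fold q. lra.
Qed.

(** The bound of [completion] being uniform, the completion of [A - lambda] and
    [B - lambda] for one small [lambda <> 0] also completes [A] and [B]. *)
Lemma invertible_completion (X Y : NormedModule C_AbsRing) (ipX : X -> X -> C) (ipY : Y -> Y -> C)
  (hX : is_inner_product ipX) (hY : is_inner_product ipY)
  (A : X -> X) (B : Y -> Y) (lA : is_linear A) (lB : is_linear B) (delta : R) :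
  banach X -> banach Y -> norm_separable X -> norm_separable Y ->
  bounded_below A -> surjective B -> 0 < delta ->
  (forall lambda : C, 0 < Cmod lambda < delta ->
    equidim (fun _ => True) (range (shift A lambda)) (kernel (shift B lambda)) (fun y => y = zero)) ->
  exists U : Y -> X, is_linear U /\ invertible (upper_triangular A U B).
Proof.
  intros bX bY sX sY [c [hc hA]] hB hd hdim.
  destruct (open_mapping bY bY lB hB) as [m [hm hBm]].
  set (k := / (c / 2) + 2 + 2 * (2 * m)).
  assert (hk : 0 < k).
  { assert (0 < / (c / 2)) by (apply Rinv_0_lt_compat; lra). unfold k; lra. }
  (* [t = lambda] is so small that the hypothesis applies, that [A - t] keeps half
     of the lower bound of [A], that [B - t] keeps twice the bound of [B], and that
     [t] times the bound [k] of the inverse of the completion is at most 1/2 *)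
  set (t := Rmin (Rmin (delta / 2) (c / 2)) (Rmin (/ (2 * m)) (/ (2 * k)))).
  assert (pm : 0 < / (2 * m)) by (apply Rinv_0_lt_compat; lra).
  assert (pk : 0 < / (2 * k)) by (apply Rinv_0_lt_compat; lra).
  assert (t0 : 0 < t) by (unfold t; repeat apply Rmin_glb_lt; lra).
  assert (t1 : t <= delta / 2) by (eapply Rle_trans; [apply Rmin_l|apply Rmin_l]).
  assert (t2 : t <= c / 2) by (eapply Rle_trans; [apply Rmin_l|apply Rmin_r]).
  assert (t3 : t * m <= / 2).
  { replace (/2) with (/ (2 * m) * m) by (field; lra).
    apply Rmult_le_compat_r; [lra|]. eapply Rle_trans; [apply Rmin_r|apply Rmin_l]. }
  assert (t4 : t * k <= / 2).
  { replace (/2) with (/ (2 * k) * k) by (field; lra).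
    apply Rmult_le_compat_r; [lra|]. eapply Rle_trans; [apply Rmin_r|apply Rmin_r]. }
  clearbody t. set (la := RtoC t).
  assert (nla : Cmod la = t) by (unfold la; rewrite Cmod_R; apply Rabs_pos_eq; lra).
  destruct (completion hX hY (is_linear_shift la lA) (is_linear_shift la lB) (c := c / 2) (m := 2 * m))
    as [U [lU [inj sur]]]; auto; try lra.
  { intros x. specialize (hA x). unfold shift.
    assert (h := norm_le_add (A x) (minus (A x) (scal la x))).
    replace (minus (A x) (minus (A x) (scal la x))) with (scal la x) in h by vec.
    rewrite norm_scal_C, nla in h. assert (n0 := norm_ge_0 x). nra. }
  { intros y. destruct (approx_surj (T := shift B la) (M := m) bY (is_linear_shift la lB)) with (y := y) as [x hx].
    - intros z. destruct (hBm z) as [x [h1 h2]]. exists x. split; auto.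
      unfold shift. rewrite h1. replace (minus z (minus z (scal la x))) with (scal la x) by vec.
      rewrite norm_scal_C, nla. assert (n0 := norm_ge_0 z).
      apply Rle_trans with (t * (m * norm z)); [apply Rmult_le_compat_l; lra|]. nra.
    - exists x. exact hx. }
  { apply hdim. rewrite nla. lra. }
  exists U. split; auto.
  set (Z := prod_NormedModule C_AbsRing X Y).
  set (M := upper_triangular A U B : Z -> Z).
  set (M' := upper_triangular (shift A la) U (shift B la) : Z -> Z).
  assert (lM : is_linear M) by now apply is_linear_upper.
  assert (lM' : is_linear M') by (apply is_linear_upper; auto; now apply is_linear_shift).
  assert (EM : forall p : Z, M p = plus (M' p) (scal la p)).
  { intros [x y]. apply injective_projections; simpl; unfold shift.
    - change (plus (A x) (U y) = plus (plus (minus (A x) (scal la x)) (U y)) (scal la x)). vec.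
    - change (B y = plus (minus (B y) (scal la y)) (scal la y)). vec. }
  fold k in sur.
  apply (invertible_of_bijective (X := Z) (T := M) (M := 2 * k) lM).
  - intros p hp. destruct (sur (scal (Copp la) p)) as [p' [h1 h2]].
    change (M' p' = scal (Copp la) p) in h1.
    assert (E : minus p p' = zero).
    { apply inj. change (M' (minus p p') = zero). rewrite (lin_minus lM'), h1.
      replace (minus (M' p) (scal (Copp la) p)) with (plus (M' p) (scal la p)) by vec.
      rewrite <- EM. exact hp. }
    assert (p = p') as <-.
    { replace p with (plus p' (minus p p')) by vec. rewrite E. vec. }
    rewrite norm_scal_C, Cmod_opp, nla in h2.
    apply norm_eq_zero. assert (n0 := norm_ge_0 p).
    assert (n1 : t * k * norm p <= / 2 * norm p) by (apply Rmult_le_compat_r; lra).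
    change (norm p <= k * (t * norm p)) in h2. lra.
  - apply (approx_surj (X := Z) (Y := Z)); auto.
    { now apply banach_prod. }
    intros q. destruct (sur q) as [p [h1 h2]]. exists p. split; auto.
    change (M' p = q) in h1. change (norm (minus (q : Z) (M p)) <= norm q / 2).
    rewrite EM, h1.
    assert (E : minus (q : Z) (plus (q : Z) (scal la (p : Z))) = scal (Copp la) (p : Z)) by vec.
    rewrite E, norm_scal_C, Cmod_opp, nla. assert (n0 := norm_ge_0 q).
    assert (n1 : t * k * norm q <= / 2 * norm q) by (apply Rmult_le_compat_r; lra).
    apply Rle_trans with (t * (k * norm q)); [apply Rmult_le_compat_l; auto; lra|]. lra.
Qed.

(** * Direct sums of an invertible and a quasinilpotent operator *)

Lemma is_inner_product_sub (X : NormedModule C_AbsRing) (ip : X -> X -> C) (S : subspace X) :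
  is_inner_product ip ->
  is_inner_product (H := sub_NormedModule S) (fun x y => ip (sub_val x) (sub_val y)).
Proof.
  intros h. split.
  - intros x y z. exact (inner_plus h _ _ _).
  - intros a x y. exact (inner_scal h _ _ _).
  - intros x y. exact (inner_conj h _ _).
  - intros x. exact (inner_norm h _).
Qed.

Lemma is_linear_restrict (X : NormedModule C_AbsRing) (T : X -> X) (S : subspace X)
  (inv : invariant T S) :
  is_linear T -> is_linear (U := sub_NormedModule S) (V := sub_NormedModule S) (restrict inv).
Proof.
  intros lT. split.
  - intros x y. apply sub_val_inj. exact (lin_plus lT _ _).
  - intros k x. apply sub_val_inj. exact (lin_scal lT _ _).
  - destruct (linear_bound lT) as [M [hM hb]]. exists M. split; auto.
    intros x. exact (hb (sub_val x)).
Qed.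

(** Coordinates identifying [Z] with the direct sum of [Z1] and [Z2]. *)
Definition decomposition (Z Z1 Z2 : NormedModule C_AbsRing)
  (i1 : Z1 -> Z) (i2 : Z2 -> Z) (p1 : Z -> Z1) (p2 : Z -> Z2) : Prop :=
  (is_linear i1 /\ is_linear i2 /\ is_linear p1 /\ is_linear p2) /\
  (forall z, plus (i1 (p1 z)) (i2 (p2 z)) = z) /\
  (forall z1, p1 (i1 z1) = z1) /\ (forall z2, p2 (i2 z2) = z2) /\
  (forall z2, p1 (i2 z2) = zero) /\ (forall z1, p2 (i1 z1) = zero).

(** The inverse of [T1], extended by zero, is a generalized Drazin inverse of
    [T]. *)
Lemma gDrazin_of_decomposition (Z Z1 Z2 : NormedModule C_AbsRing) i1 i2 p1 p2
  (T : Z -> Z) (T1 : Z1 -> Z1) (T2 : Z2 -> Z2) :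
  decomposition i1 i2 p1 p2 -> is_linear T ->
  (forall z, T (i1 z) = i1 (T1 z)) -> (forall z, T (i2 z) = i2 (T2 z)) ->
  invertible T1 -> quasinilpotent T2 -> generalized_Drazin_invertible T.
Proof.
  intros [[li1 [li2 [lp1 lp2]]] [hz [h11 [h22 [h12 h21]]]]] lT E1 E2 [J [lJ [J1 J2]]] hq.
  assert (P1 : forall z, p1 (T z) = T1 (p1 z)).
  { intros z. rewrite <- (hz z) at 1.
    rewrite (lin_plus lT), E1, E2, (lin_plus lp1), h11, h12. vec. }
  assert (P2 : forall z, p2 (T z) = T2 (p2 z)).
  { intros z. rewrite <- (hz z) at 1.
    rewrite (lin_plus lT), E1, E2, (lin_plus lp2), h21, h22. vec. }
  exists (fun z => i1 (J (p1 z))).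
  split; [|split; [|split]].
  - apply (is_linear_comp (fun z => J (p1 z)) i1); auto. now apply (is_linear_comp p1 J).
  - intros z. rewrite E1, P1, J1, J2. reflexivity.
  - intros z. rewrite E1, h11, J2. reflexivity.
  - intros mu hmu.
    assert (hmu' : Copp mu <> RtoC 0).
    { intros E. apply hmu. replace mu with (Copp (Copp mu)) by ring. rewrite E. ring. }
    destruct (hq (Copp mu) hmu') as [R [lR [R1 R2]]].
    set (N := shift (fun z => minus (T (i1 (J (p1 (T z))))) (T z)) mu).
    (* the defect [TST - T] vanishes on the first summand and is [- T2] on the second *)
    assert (EN : forall z, N z = minus (i1 (scal (Copp mu) (p1 z))) (i2 (shift T2 (Copp mu) (p2 z)))).
    { intros z. unfold N, shift. rewrite E1, P1, J1.
      rewrite (lin_scal li1), (lin_minus li2), (lin_scal li2).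
      assert (ET : T z = plus (i1 (T1 (p1 z))) (i2 (T2 (p2 z)))).
      { rewrite <- (hz z) at 1. rewrite (lin_plus lT), E1, E2. reflexivity. }
      rewrite ET.
      replace (scal mu z) with (scal mu (plus (i1 (p1 z)) (i2 (p2 z)))) by now rewrite hz.
      vec. }
    assert (N1 : forall z, p1 (N z) = scal (Copp mu) (p1 z)).
    { intros z. rewrite EN, (lin_minus lp1), h11, h12. vec. }
    assert (N2 : forall z, p2 (N z) = opp (shift T2 (Copp mu) (p2 z))).
    { intros z. rewrite EN, (lin_minus lp2), h22, h21. vec. }
    exists (fun w => minus (i1 (scal (Cinv (Copp mu)) (p1 w))) (i2 (R (p2 w)))).
    split; [|split].
    + apply (is_linear_sub (S := fun w => i1 (scal (Cinv (Copp mu)) (p1 w))) (T := fun w => i2 (R (p2 w)))).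
      * apply (is_linear_comp (fun w => scal (Cinv (Copp mu)) (p1 w)) i1); auto.
        now apply is_linear_cscal.
      * apply (is_linear_comp (fun w => R (p2 w)) i2); auto. now apply (is_linear_comp p2 R).
    + intros z. change (minus (i1 (scal (Cinv (Copp mu)) (p1 (N z)))) (i2 (R (p2 (N z)))) = z).
      rewrite N1, N2.
      replace (R (opp (shift T2 (Copp mu) (p2 z)))) with (opp (p2 z)).
      2: { replace (opp (shift T2 (Copp mu) (p2 z))) with (scal (Copp 1) (shift T2 (Copp mu) (p2 z))) by vec.
           rewrite (lin_scal lR), R1. vec. }
      replace (scal (Cinv (Copp mu)) (scal (Copp mu) (p1 z))) with (p1 z) by (vec; field; auto).
      replace (opp (p2 z)) with (scal (Copp 1) (p2 z)) by vec.
      rewrite (lin_scal li2). etransitivity; [|apply hz]. vec.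
    + intros w. fold N. rewrite EN.
      assert (F1 : p1 (minus (i1 (scal (Cinv (Copp mu)) (p1 w))) (i2 (R (p2 w))))
                   = scal (Cinv (Copp mu)) (p1 w)).
      { rewrite (lin_minus lp1), h11, h12. vec. }
      assert (F2 : p2 (minus (i1 (scal (Cinv (Copp mu)) (p1 w))) (i2 (R (p2 w))))
                   = scal (Copp 1) (R (p2 w))).
      { rewrite (lin_minus lp2), h21, h22. vec. }
      rewrite F1, F2.
      assert (Esh : shift T2 (Copp mu) (scal (Copp 1) (R (p2 w))) = scal (Copp 1) (p2 w)).
      { assert (lT2 : is_linear T2).
        { apply (is_linear_ext (fun z => p2 (T (i2 z)))); [intros z; rewrite E2; apply h22|].
          apply (is_linear_comp (fun z => T (i2 z)) p2); auto. now apply (is_linear_comp i2 T). }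
        rewrite (lin_scal (is_linear_shift (Copp mu) lT2)), R2. reflexivity. }
      rewrite Esh, (lin_scal li2).
      replace (scal (Copp mu) (scal (Cinv (Copp mu)) (p1 w))) with (p1 w) by (vec; field; auto).
      etransitivity; [|apply hz]. vec.
Qed.

Lemma quasinilpotent_diag (X Y : NormedModule C_AbsRing) (A : X -> X) (B : Y -> Y) :
  quasinilpotent A -> quasinilpotent B ->
  quasinilpotent (upper_triangular A (fun _ => zero) B).
Proof.
  intros hA hB la hla. destruct (hA la hla) as [R [lR [R1 R2]]]. destruct (hB la hla) as [Q [lQ [Q1 Q2]]].
  assert (E : forall x y, shift (upper_triangular A (fun _ => zero) B) la (x, y)
     = (shift A la x, shift B la y)).
  { intros x y. apply injective_projections; [|reflexivity].
    change (minus (plus (A x) zero) (scal la x) = minus (A x) (scal la x)). vec. }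
  exists (fun p => (R (fst p), Q (snd p))). split; [|split].
  - apply (is_linear_prod (T := prod_NormedModule C_AbsRing X Y) (fun p => R (fst p)) (fun p => Q (snd p))).
    + apply (is_linear_comp (U := prod_NormedModule C_AbsRing X Y) fst R); auto. apply is_linear_fst.
    + apply (is_linear_comp (U := prod_NormedModule C_AbsRing X Y) snd Q); auto. apply is_linear_snd.
  - intros [x y]. rewrite E. simpl. rewrite R1, Q1. reflexivity.
  - intros [x y]. rewrite E. simpl. rewrite R2, Q2. reflexivity.
Qed.

(** If [X] is the direct sum of the [A]-invariant subspaces [S1] and [S2] and
    [A - lambda] is invertible on [S2], then [A - lambda] and its restriction
    to [S1] have ranges of the same codimension. *)
Lemma has_basis_range_restrict (X : NormedModule C_AbsRing) (A : X -> X) (S1 S2 : subspace X)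
  (inv1 : invariant A S1) (inv2 : invariant A S2) p1 p2 (la : C) n :
  is_linear A ->
  decomposition (Z := X) (Z1 := sub_NormedModule S1) (Z2 := sub_NormedModule S2)
    (@sub_val X S1) (@sub_val X S2) p1 p2 ->
  invertible (X := sub_NormedModule S2) (shift (X := sub_NormedModule S2) (restrict inv2) la) ->
  has_basis (fun _ => True) (range (shift A la)) n <->
  has_basis (X := sub_NormedModule S1) (fun _ => True)
    (range (X := sub_NormedModule S1) (shift (X := sub_NormedModule S1) (restrict inv1) la)) n.
Proof.
  intros lA [[li1 [li2 [lp1 lp2]]] [hz [h11 [h22 [h12 h21]]]]] [R [lR [R1 R2]]].
  assert (l1 := is_linear_shift (X := sub_NormedModule S1) la (is_linear_restrict inv1 lA)).
  assert (lS := is_linear_shift la lA).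
  assert (C1 : forall x, shift A la (sub_val x) = sub_val (shift (X := sub_NormedModule S1) (restrict inv1) la x))
    by reflexivity.
  assert (C2 : forall x, shift A la (sub_val x) = sub_val (shift (X := sub_NormedModule S2) (restrict inv2) la x))
    by reflexivity.
  assert (M1 : forall y : sub_NormedModule S1, minus y (p1 (sub_val y)) = zero).
  { intros y. etransitivity; [apply (f_equal (minus y)), h11|].
    apply (minus_eq_zero (G := sub_NormedModule S1)). }
  assert (P1 : forall x, p1 (shift A la x) = shift (X := sub_NormedModule S1) (restrict inv1) la (p1 x)).
  { intros x. rewrite <- (hz x) at 1. rewrite (lin_plus lS), C1, C2, (lin_plus lp1).
    etransitivity; [apply f_equal2; [apply h11|apply h12]|]. apply (plus_zero_r (G := sub_NormedModule S1)). }
  assert (hr : forall x, range (shift A la) (minus x (sub_val (p1 x)))).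
  { intros x. exists (sub_val (R (p2 x))). rewrite C2, R2.
    transitivity (minus (plus (sub_val (p1 x)) (sub_val (p2 x))) (sub_val (p1 x))); [vec|].
    now rewrite hz. }
  split.
  - apply (has_basis_map (Y := sub_NormedModule S1) (phi := p1) (psi := @sub_val X S1)
      (V := full_sub X) (W := range_sub lS) (V' := full_sub (sub_NormedModule S1)) (W' := range_sub l1)); auto.
    + intros x [z <-]. exists (p1 z). symmetry; apply P1.
    + intros y [z <-]. exists (sub_val z). apply C1.
    + intros x _. apply hr.
    + intros y _. exists zero. transitivity (zero : sub_NormedModule S1).
      * exact (lin_zero l1).
      * symmetry. exact (M1 y).
  - apply (has_basis_map (X := sub_NormedModule S1) (psi := p1) (phi := @sub_val X S1)
      (V' := full_sub X) (W' := range_sub lS) (V := full_sub (sub_NormedModule S1)) (W := range_sub l1)); auto.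
    + intros y [z <-]. exists (sub_val z). apply C1.
    + intros x [z <-]. exists (p1 z). symmetry; apply P1.
    + intros y _. exists zero. transitivity (zero : sub_NormedModule S1).
      * exact (lin_zero l1).
      * symmetry. exact (M1 y).
    + intros x _. apply hr.
Qed.

(** Likewise [B - lambda] and its restriction to [S1] have kernels of the same
    dimension: the kernel of [B - lambda] is contained in [S1]. *)
Lemma has_basis_kernel_restrict (X : NormedModule C_AbsRing) (B : X -> X) (S1 S2 : subspace X)
  (inv1 : invariant B S1) (inv2 : invariant B S2) p1 p2 (la : C) n :
  is_linear B ->
  decomposition (Z := X) (Z1 := sub_NormedModule S1) (Z2 := sub_NormedModule S2)
    (@sub_val X S1) (@sub_val X S2) p1 p2 ->
  invertible (X := sub_NormedModule S2) (shift (X := sub_NormedModule S2) (restrict inv2) la) ->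
  has_basis (kernel (shift B la)) (fun x => x = zero) n <->
  has_basis (X := sub_NormedModule S1)
    (kernel (X := sub_NormedModule S1) (shift (X := sub_NormedModule S1) (restrict inv1) la))
    (fun x => x = zero) n.
Proof.
  intros lB [[li1 [li2 [lp1 lp2]]] [hz [h11 [h22 [h12 h21]]]]] [R [lR [R1 R2]]].
  assert (l1 := is_linear_shift (X := sub_NormedModule S1) la (is_linear_restrict inv1 lB)).
  assert (lS := is_linear_shift la lB).
  assert (C1 : forall x, shift B la (sub_val x) = sub_val (shift (X := sub_NormedModule S1) (restrict inv1) la x))
    by reflexivity.
  assert (C2 : forall x, shift B la (sub_val x) = sub_val (shift (X := sub_NormedModule S2) (restrict inv2) la x))
    by reflexivity.
  assert (M1 : forall y : sub_NormedModule S1, minus y (p1 (sub_val y)) = zero).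
  { intros y. etransitivity; [apply (f_equal (minus y)), h11|].
    apply (minus_eq_zero (G := sub_NormedModule S1)). }
  assert (P1 : forall x, p1 (shift B la x) = shift (X := sub_NormedModule S1) (restrict inv1) la (p1 x)).
  { intros x. rewrite <- (hz x) at 1. rewrite (lin_plus lS), C1, C2, (lin_plus lp1).
    etransitivity; [apply f_equal2; [apply h11|apply h12]|]. apply (plus_zero_r (G := sub_NormedModule S1)). }
  assert (P2 : forall x, p2 (shift B la x) = shift (X := sub_NormedModule S2) (restrict inv2) la (p2 x)).
  { intros x. rewrite <- (hz x) at 1. rewrite (lin_plus lS), C1, C2, (lin_plus lp2).
    etransitivity; [apply f_equal2; [apply h21|apply h22]|]. apply (plus_zero_l (G := sub_NormedModule S2)). }
  assert (K1 : forall x, shift B la x = zero -> shift (X := sub_NormedModule S1) (restrict inv1) la (p1 x) = zero).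
  { intros x hx. rewrite <- P1, hx. apply (lin_zero lp1). }
  assert (K2 : forall x, shift B la x = zero -> x = sub_val (p1 x)).
  { intros x hx. rewrite <- (hz x) at 1.
    assert (E : p2 x = zero).
    { rewrite <- (R1 (p2 x)), <- P2, hx, (lin_zero lp2). apply (lin_zero lR). }
    rewrite E, (lin_zero li2). vec. }
  assert (K3 : forall y, shift (X := sub_NormedModule S1) (restrict inv1) la y = zero -> shift B la (sub_val y) = zero).
  { intros y hy. rewrite C1, hy. reflexivity. }
  split.
  - apply (has_basis_map (Y := sub_NormedModule S1) (phi := p1) (psi := @sub_val X S1)
      (V := kernel_sub lS) (W := zero_sub X) (V' := kernel_sub l1) (W' := zero_sub (sub_NormedModule S1))); auto.
    + intros x hx. rewrite hx. apply (lin_zero lp1).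
    + intros x hx. rewrite hx. reflexivity.
    + intros x hx. rewrite <- (K2 x hx). apply (minus_eq_zero x).
    + intros y _. exact (M1 y).
  - apply (has_basis_map (X := sub_NormedModule S1) (psi := p1) (phi := @sub_val X S1)
      (V' := kernel_sub lS) (W' := zero_sub X) (V := kernel_sub l1) (W := zero_sub (sub_NormedModule S1))); auto.
    + intros x hx. rewrite hx. reflexivity.
    + intros x hx. rewrite hx. apply (lin_zero lp1).
    + intros y _. exact (M1 y).
    + intros x hx. rewrite <- (K2 x hx). apply (minus_eq_zero x).
Qed.

Lemma direct_sum_decomposition (X : NormedModule C_AbsRing) (S1 S2 : subspace X) :
  banach X -> closed S1 -> closed S2 -> direct_sum S1 S2 ->
  exists p1 p2, decomposition (Z := X) (Z1 := sub_NormedModule S1) (Z2 := sub_NormedModule S2)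
    (@sub_val X S1) (@sub_val X S2) p1 p2.
Proof.
  intros bX c1 c2 hs. destruct (direct_sum_proj bX c1 c2 hs) as [p1 [p2 [l1 [l2 [hz h]]]]].
  assert (a1 : forall x : sub_sort S1, sub_val x = plus (sub_val x) (sub_val (zero : sub_NormedModule S2))).
  { intros x. symmetry. exact (plus_zero_r (sub_val x)). }
  assert (a2 : forall x : sub_sort S2, sub_val x = plus (sub_val (zero : sub_NormedModule S1)) (sub_val x)).
  { intros x. symmetry. exact (plus_zero_l (sub_val x)). }
  exists p1, p2. split; [|split; [|split; [|split; [|split]]]]; auto.
  - split; [apply is_linear_sub_val|split; [apply is_linear_sub_val|split; auto]].
  - intros x. rewrite a1. apply h.
  - intros x. rewrite a2. apply h.
  - intros x. rewrite a2. apply h.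
  - intros x. rewrite a1. apply h.
Qed.

Lemma is_linear_prod_map (X Y X' Y' : NormedModule C_AbsRing) (S : X -> X') (T : Y -> Y') :
  is_linear S -> is_linear T ->
  is_linear (U := prod_NormedModule C_AbsRing X Y) (V := prod_NormedModule C_AbsRing X' Y')
    (fun p => (S (fst p), T (snd p))).
Proof.
  intros hS hT.
  apply (is_linear_prod (T := prod_NormedModule C_AbsRing X Y) (fun p => S (fst p)) (fun p => T (snd p))).
  - apply (is_linear_comp (U := prod_NormedModule C_AbsRing X Y) fst S); auto. apply is_linear_fst.
  - apply (is_linear_comp (U := prod_NormedModule C_AbsRing X Y) snd T); auto. apply is_linear_snd.
Qed.

Lemma decomposition_prod (X X1 X2 Y Y1 Y2 : NormedModule C_AbsRing) i1 i2 p1 p2 j1 j2 q1 q2 :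
  decomposition (Z := X) (Z1 := X1) (Z2 := X2) i1 i2 p1 p2 ->
  decomposition (Z := Y) (Z1 := Y1) (Z2 := Y2) j1 j2 q1 q2 ->
  decomposition (Z := prod_NormedModule C_AbsRing X Y) (Z1 := prod_NormedModule C_AbsRing X1 Y1)
    (Z2 := prod_NormedModule C_AbsRing X2 Y2)
    (fun p => (i1 (fst p), j1 (snd p))) (fun p => (i2 (fst p), j2 (snd p)))
    (fun p => (p1 (fst p), q1 (snd p))) (fun p => (p2 (fst p), q2 (snd p))).
Proof.
  intros [[a1 [a2 [a3 a4]]] [a5 [a6 [a7 [a8 a9]]]]] [[b1 [b2 [b3 b4]]] [b5 [b6 [b7 [b8 b9]]]]].
  split; [|split; [|split; [|split; [|split]]]].
  - split; [|split; [|split]]; now apply is_linear_prod_map.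
  - intros [x y]. apply injective_projections; [apply a5|apply b5].
  - intros [x y]. simpl. now rewrite a6, b6.
  - intros [x y]. simpl. now rewrite a7, b7.
  - intros [x y]. simpl. rewrite a8, b8. reflexivity.
  - intros [x y]. simpl. rewrite a9, b9. reflexivity.
Qed.

Theorem theorem2p4 (H K : HilbertSpace)
  (sepH : separable H) (sepK : separable K)
  (A : H -> H) (B : K -> K) (linA : is_linear A) (linB : is_linear B)
  (hA : exists (H1 H2 : subspace H) (inv1 : invariant A H1) (inv2 : invariant A H2),
      closed H1 /\ closed H2 /\ direct_sum H1 H2 /\
      bounded_below (restrict inv1) /\ quasinilpotent (restrict inv2))
  (hB : exists (K1 K2 : subspace K) (inv1 : invariant B K1) (inv2 : invariant B K2),
      closed K1 /\ closed K2 /\ direct_sum K1 K2 /\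
      surjective (restrict inv1) /\ quasinilpotent (restrict inv2))
  (hAB : exists delta : R, 0 < delta /\
      forall lambda : C, 0 < Cmod lambda < delta ->
        beta (shift A lambda) = alpha (shift B lambda)) :
  exists C : K -> H, is_linear C /\
    generalized_Drazin_invertible (upper_triangular A C B).
Proof.
  destruct hA as [H1 [H2 [inv1 [inv2 [cH1 [cH2 [dH [bA qA]]]]]]]].
  destruct hB as [K1 [K2 [jnv1 [jnv2 [cK1 [cK2 [dK [sB qB]]]]]]]].
  destruct hAB as [delta [hdelta hdim]].
  assert (bH : banach H) by apply banach_complete.
  assert (bK : banach K) by apply banach_complete.
  destruct (direct_sum_decomposition bH cH1 cH2 dH) as [p1 [p2 dp]].
  destruct (direct_sum_decomposition bK cK1 cK2 dK) as [q1 [q2 dq]].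
  destruct (invertible_completion (delta := delta)
    (is_inner_product_sub H1 (inner_ax H)) (is_inner_product_sub K1 (inner_ax K))
    (is_linear_restrict inv1 linA) (is_linear_restrict jnv1 linB)) as [U [lU invU]]; auto.
  { now apply banach_sub. }
  { now apply banach_sub. }
  { apply norm_separable_sub. now apply norm_separable_of. }
  { apply norm_separable_sub. now apply norm_separable_of. }
  { intros la hla.
    assert (hla0 : la <> RtoC 0) by (apply Cmod_gt_0; apply hla).
    apply (equidim_map (fun n => has_basis_range_restrict inv1 n linA dp (qA la hla0))
      (fun n => has_basis_kernel_restrict jnv1 n linB dq (qB la hla0))).
    exact (equidim_of_quotient_dim (hdim la hla)). }
  assert (D := decomposition_prod dp dq).
  destruct dp as [[li1 [li2 [lp1 lp2]]] [hz [h11 [h22 [h12 h21]]]]].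
  destruct dq as [[lj1 [lj2 [lq1 lq2]]] [kz [k11 [k22 [k12 k21]]]]].
  (* [U] extended by zero on [K2] *)
  set (C := fun y : K => sub_val (U (q1 y)) : H).
  assert (lC : is_linear C).
  { apply (is_linear_comp (fun y => U (q1 y)) (@sub_val H H1)); auto. now apply (is_linear_comp q1 U). }
  exists C. split; auto.
  apply (gDrazin_of_decomposition D (T := upper_triangular A C B)
    (T1 := upper_triangular (X := sub_NormedModule H1) (Y := sub_NormedModule K1) (restrict inv1) U (restrict jnv1))
    (T2 := upper_triangular (X := sub_NormedModule H2) (Y := sub_NormedModule K2) (restrict inv2) (fun _ => zero) (restrict jnv2))).
  - now apply is_linear_upper.
  - intros [x y]. apply injective_projections; [|reflexivity]. simpl. unfold C. rewrite k11. reflexivity.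
  - intros [x y]. apply injective_projections; [|reflexivity]. simpl. unfold C. rewrite k12, (lin_zero lU). reflexivity.
  - exact invU.
  - now apply quasinilpotent_diag.
Qed.
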